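(* Assume $\mathbb E[\tanh(h)]=0$ and $0<\theta_1<\theta_c:=\frac{1}{\mathbb E[\operatorname{sech}^2(h)]}$. Then the High Temperature Test (described in the context, with a suitable choice of threshold $\tau_\delta$ in the stated intervals) is asymptotically powerful when 1. $k=o(n^{2/3})$ and $m\gtrsim k\log n$; 2. $n^{2/3}\lesssim k\le n$ and $m\gtrsim\frac{n^2}{k^2}$. (Here $m\gtrsim r$ means $m\ge C r$ for a sufficiently large constant $C$ not depending on $n,k,m$.)
   Context: Planted random field Curie-Weiss (pRFCW) model. Let $\mu$ be a probability measure on $\mathbb R$, $h\sim\mu$, $\theta_1>0$, $[n]=\{1,\dots,n\}$, and $h_1,\dots,h_n$ i.i.d. $\sim\mu$, $\boldsymbol h=(h_1,\dots,h_n)$. For $S\subset[n]$ with $|S|=k$ define, for $\boldsymbol\sigma\in\{-1,+1\}^n$, $$\mathbb P_S(\boldsymbol\sigma\mid\boldsymbol h)\propto\exp\Big(\frac{\theta_1}{2k}\sum_{i,j\in S}\sigma_i\sigma_j+\sum_{i=1}^n h_i\sigma_i\Big),\qquad \mathbb P_0(\boldsymbol\sigma\mid\boldsymbol h)\propto\exp\Big(\sum_{i=1}^n h_i\sigma_i\Big),$$ each normalized, and $\mathbb P_S(\boldsymbol\sigma)=\mathbb E_{\boldsymbol h}[\mathbb P_S(\boldsymbol\sigma\mid\boldsymbol h)]$, $\mathbb P_0(\boldsymbol\sigma)=\mathbb E_{\boldsymbol h}[\mathbb P_0(\boldsymbol\sigma\mid\boldsymbol h)]$. One observes $m$ i.i.d.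 samples $\boldsymbol\sigma^{(1)},\dots,\boldsymbol\sigma^{(m)}$; $\mathbb P_{0,m}$, $\mathbb P_{S,m}$ are the $m$-fold products of $\mathbb P_0$, $\mathbb P_S$. Asymptotics: $k\to\infty$ with $n=n(k)\ge k$, $m=m(k)\ge1$; $\mu,\theta_1$ fixed. A sequence of tests $\psi$ ($\{0,1\}$-valued functions of the $m$ samples; $\psi=1$ means reject the null) is asymptotically powerful if $$\lim_{k\to\infty}\Big[\mathbb P_{0,m}(\psi=1)+\sup_{S:|S|=k}\mathbb P_{S,m}(\psi=0)\Big]=0.$$ High Temperature Test. Write $a=\mathbb E[\operatorname{sech}^2(h)]$ and $\widehat{\mathbb E}[\boldsymbol\sigma\boldsymbol\sigma^\top]=\frac1m\sum_{i=1}^m\boldsymbol\sigma^{(i)}\boldsymbol\sigma^{(i)\top}$; $\mathbb 1_S\in\{0,1\}^n$ is the indicator vector of $S$. - If $k=o(n^{2/3})$: for each $S\subset[n]$, $|S|=k$, compute $\phi_S=\frac1k\mathbb 1_S^\top\widehat{\mathbb E}[\boldsymbol\sigma\boldsymbol\sigma^\top]\mathbb 1_S$, and reject the null if $\phi_1=\sup_{S:|S|=k}\phi_S\ge\tau_\delta$, where $\tau_\delta\in\left(0,\frac{1-\theta_1a^2}{(1-\theta_1a)^2}\right)$. - Otherwise: compute $\phi_2=\frac{1}{mk}\sum_{j=1}^m\Big(\big(\sum_{i=1}^n\sigma_i^{(j)}\big)^2-n\Big)$ and reject the null if $\phi_2>\tau_\delta$, where $\tau_\delta\in\left(0,\fr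ac{2\theta_1a-\theta_1(1+\theta_1)a^2}{(1-\theta_1a)^2}\right)$.
   Formalization: In part 2, risk tending to 0 with a fixed C is false (h=0, k=n, m constant). It is replaced by: for each ε some C(ε) with m ≥ C(ε) n²/k² gives risk ≤ ε for all large k; and the test is asymptotically powerful when m k²/n² → ∞. *)

(* Defs.v *)
From HB Require Import structures.
From mathcomp Require Import all_boot all_order all_algebra.
From mathcomp Require Import all_classical all_reals all_analysis.
Set Implicit Arguments.
Unset Strict Implicit.
Unset Printing Implicit Defensive.
Import Order.TTheory GRing.Theory Num.Theory.
Import numFieldNormedType.Exports.
Local Open Scope classical_set_scope.
Local Open Scope ring_scope.

Section hyperbolic.
Variable R : realType.

Definition tanh (x : R) : R := (expR x - expR (- x)) / (expR x + expR (- x)).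
Definition sech (x : R) : R := 2 / (expR x + expR (- x)).

End hyperbolic.

Section iid.
Context (d : measure_display) (T : measurableType d) (R : realType).
Variable mu : probability T R.

Definition cons_pair n (p : T * n.-tuple T) : n.+1.-tuple T :=
  [the n.+1.-tuple T of p.1 :: p.2].

Lemma measurable_cons_pair n : measurable_fun setT (@cons_pair n).
Proof. exact: measurable_cons measurable_fst measurable_snd. Qed.

HB.instance Definition _ n :=
  isMeasurableFun.Build _ _ _ _ (@cons_pair n) (@measurable_cons_pair n).

(* n-fold product of mu: mu^0 is the point mass at the empty tuple and
   mu^(n+1) is the image of mu \x mu^n under (x, t) |-> x :: t. *)
Fixpoint iid_law n : probability (n.-tuple T) R :=
  match n with
  | 0 => \d_([tuple] : 0.-tuple T)
  | n'.+1 => distribution (mu \x iid_law n')%E (@cons_pair n')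
  end.

Lemma iid_law_rect n (A : 'I_n -> set T) : (forall i, measurable (A i)) ->
  iid_law n [set t | forall i, A i (tnth t i)] = (\prod_(i < n) mu (A i))%E.
Proof.
have mrect k (B : 'I_k -> set T) : (forall i, measurable (B i)) ->
    measurable [set t : k.-tuple T | forall i, B i (tnth t i)].
  move=> mB.
  have -> : [set t : k.-tuple T | forall i, B i (tnth t i)] =
      \big[setI/setT]_(i < k) ((@tnth k T)^~ i @^-1` B i).
    apply/seteqP; split=> t /= => [Bt|].
      apply: (big_ind (fun X : set (k.-tuple T) => X t)) => //.
      by move=> i _; exact: Bt.
    by move=> + i; rewrite (bigD1 i) //= => -[].
  apply: bigsetI_measurable => i _.
  by rewrite -[X in measurable X]setTI; exact: measurable_tnth.
elim: n A => [|n IHn] A mA.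
  by rewrite big_ord0 /= diracE mem_set // => -[].
rewrite big_ord_recl -(IHn (fun i => A (lift ord0 i))) //= /distribution.
have mA' := mrect _ _ (fun i => mA (lift ord0 i)).
rewrite -(product_measure1E mu (iid_law n) (mA ord0) mA').
congr (_ _); apply/seteqP; split=> -[x t] /=.
  move=> At; split; first by have := At ord0.
  by move=> i; have := At (lift ord0 i); rewrite tnthS.
move=> [Ax At] i; case: (unliftP ord0 i) => [j|] ->; last exact: Ax.
by rewrite tnthS; exact: At.
Qed.

End iid.

Section planted_rfcw.
Variable R : realType.
Implicit Types (n m : nat) (theta : R).

(* sigma in {-1,+1}^n, encoded with true = +1 and false = -1 *)
Definition config n := {ffun 'I_n -> bool}.
Definition sample n m := {ffun 'I_m -> config n}.
Definition test n m := pred (sample n m).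

Definition spin n (s : config n) (i : 'I_n) : R := if s i then 1 else -1.

Definition field_energy n (h : n.-tuple R) (s : config n) : R :=
  \sum_(i < n) tnth h i * spin s i.

Definition planted_weight theta n (S : {set 'I_n}) (h : n.-tuple R)
    (s : config n) : R :=
  expR (theta / (2 * #|S|%:R) * (\sum_(i in S) \sum_(j in S) spin s i * spin s j)
        + field_energy h s).

Definition null_weight n (h : n.-tuple R) (s : config n) : R :=
  expR (field_energy h s).

Definition normalized n (w : config n -> R) (s : config n) : R :=
  w s / \sum_(t : config n) w t.

Definition planted_cond theta n (S : {set 'I_n}) (h : n.-tuple R) :=
  normalized (planted_weight theta S h).

Definition null_cond n (h : n.-tuple R) := normalized (null_weight h).

Variable mu : probability (measurableTypeR R) R.

Definition mean (f : R -> R) : R := fine 'E_mu[f].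

Definition field_mean n (f : n.-tuple (measurableTypeR R) -> R) : R :=
  fine 'E_(iid_law mu n)[f].

Definition planted_law theta n (S : {set 'I_n}) (s : config n) : R :=
  field_mean (fun h => planted_cond theta S h s).

Definition null_law n (s : config n) : R :=
  field_mean (fun h => null_cond h s).

(* probability of the event A under the m-fold product of P *)
Definition iid_prob n m (P : config n -> R) (A : pred (sample n m)) : R :=
  \sum_(x : sample n m | A x) \prod_(j < m) P (x j).

(* the max ranges over nonnegative terms, so the default value 0 is harmless *)
Definition risk theta k n m (psi : test n m) : R :=
  iid_prob (@null_law n) psi +
  \big[Num.max/0]_(S : {set 'I_n} | #|S| == k)
    iid_prob (planted_law theta S) (predC psi).

Definition asymptotically_powerful theta (n m : nat -> nat)
    (psi : forall k, test (n k) (m k)) : Prop :=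
  risk theta k (psi k) @[k --> \oo] --> (0 : R).

Definition spin_col n (s : config n) : 'cV[R]_n := \col_i spin s i.
Definition indicator n (S : {set 'I_n}) : 'cV[R]_n := \col_i (i \in S)%:R.

Definition empirical_second_moment n m (x : sample n m) : 'M[R]_n :=
  m%:R^-1 *: \sum_(j < m) (spin_col (x j) *m (spin_col (x j))^T).

Definition phi_set k n m (S : {set 'I_n}) (x : sample n m) : R :=
  k%:R^-1 * ((indicator S)^T *m empirical_second_moment x *m indicator S) 0 0.

(* phi_set is nonnegative, so the default value 0 does not affect the max *)
Definition phi1 k n m (x : sample n m) : R :=
  \big[Num.max/0]_(S : {set 'I_n} | #|S| == k) phi_set k S x.

Definition phi2 k n m (x : sample n m) : R :=
  (m%:R * k%:R)^-1 *
  \sum_(j < m) ((\sum_(i < n) spin (x j) i) ^+ 2 - n%:R).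

Definition small_planted_set (n : nat -> nat) : Prop :=
  (fun k => k%:R : R^o) =o_\oo (fun k => (n k)%:R `^ (2 / 3) : R^o).

Definition high_temperature_test (tau1 tau2 : R) (n m : nat -> nat) (k : nat) :
    test (n k) (m k) :=
  fun x => if `[< small_planted_set n >] then tau1 <= phi1 k x else tau2 < phi2 k x.

End planted_rfcw.

Arguments high_temperature_test {R} tau1 tau2 n m k _.
Arguments asymptotically_powerful {R} mu theta {n m} psi.

(* Main.v *)
Require Import Defs.
From HB Require Import structures.
From mathcomp Require Import all_boot all_order all_algebra.
From mathcomp Require Import all_classical all_reals all_analysis.
From mathcomp Require Import measurable_realfun ring lra.
Import Order.TTheory GRing.Theory Num.Theory.
Import numFieldNormedType.Exports.
Local Open Scope classical_set_scope.
Local Open Scope ring_scope.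

Set Implicit Arguments.
Unset Strict Implicit.
Unset Printing Implicit Defensive.

(** Under the null law the spins are independent fair coins, because
    [tanh h] has mean 0.  Under the law planted on [S] the spins outside [S] are
    still independent fair coins ([planted_law_twist]), and the whole signal lies
    in the squared magnetization [U = (sum of the spins in S)^2 / k], whose mean
    is 1 under the null law.

    The heart of the proof is that the planted mean of [U], even truncated at a
    constant [M], exceeds 1 by a constant [kappa > 0] that does not depend on
    [n], [k] and [S] ([planted_gain]).  Given the field [h], the planted law is
    the law of independent spins with means [tanh h_i], tilted by
    [exp (theta U / 2)].  An exponential tilt raises the mean of an increasing
    function of [U] at least as much as the tilt [1 + t U] with
    [t <= theta / 2], since the ratio of the two weights is increasing
    ([association]).  For the linear tilt the gain is, to first order in [t], the
    variance of [U] at fixed field ([truncated_tilt_ge]).  Averaging over the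
    field only involves the first moments of [U] and, for the square of its mean
    at fixed field, two copies of the spins with correlation
    [q = E tanh(h)^2 = 1 - a] at each site ([field_mean_sqr]); the averaged
    variance is [(2 - 2 / k) (1 - q^2)], which is bounded away from 0.  This
    argument bounds [U] from below only, and truncation makes the lower bound
    usable: it gives a bounded variable, so sample averages of [U] are above
    [1 + kappa / 2], say, except with probability [O(1/m)].  The magnetization
    may well be of a larger order than [sqrt k].

    Scan statistic.  Under the null law the Laplace transform of [U] is at most
    the chi-square one ([spin_sum_sqr_mgf]), so a given set exceeds a threshold
    above 1 with probability [exp (- c m)], and a union bound over the at most
    [n^k] sets is beaten as soon as [m >= (2 / c) k log n].

    Sum statistic.  Under the null law its variance is at most
    [2 n^2 / (m k^2)].  Under the planted law, condition on the spins in [S] and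
    use that the others are fresh fair coins ([product_mean_scramble]): the
    excess of the conditional mean over the threshold and the conditional
    variance are both controlled by the average of [U], and Chebyshev's inequality
    gives [O(n^2 / (m k^2))] however large [U] is ([fresh_coins_tail]).

    All these bounds hold for every [2 <= k <= n]; the asymptotic statements
    follow from them. *)

(** * Averages over the random field *)

(** A class stable under sums and products, containing every function of the
    field that has to be averaged, on which the mean is linear. *)
Definition bounded_measurable (R : realType) d (T : measurableType d)
    (f : T -> R) :=
  measurable_fun setT f /\ exists c, forall x, `|f x| <= c.

Section bounded_measurable.
Context (R : realType) d (T : measurableType d).
Implicit Types f g : T -> R.

Lemma bm_cst (c : R) : bounded_measurable (fun _ : T => c).
Proof. by split; [exact: measurable_cst | exists `|c|]. Qed.

Lemma bm_add f g : bounded_measurable f -> bounded_measurable g ->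
  bounded_measurable (fun x => f x + g x).
Proof.
move=> [mf [c fc]] [mg [e ge]]; split; first exact: measurable_funD.
by exists (c + e) => x; rewrite (le_trans (ler_normD _ _))// lerD.
Qed.

Lemma bm_mul f g : bounded_measurable f -> bounded_measurable g ->
  bounded_measurable (fun x => f x * g x).
Proof.
move=> [mf [c fc]] [mg [e ge]]; split; first exact: measurable_funM.
by exists (c * e) => x; rewrite normrM ler_pM.
Qed.

Lemma bm_sum (I : Type) (r : seq I) (P : pred I) (F : I -> T -> R) :
  (forall i, bounded_measurable (F i)) ->
  bounded_measurable (fun x => \sum_(i <- r | P i) F i x).
Proof.
move=> bF; elim: r => [|i r IHr].
  by under eq_fun do rewrite big_nil; exact: bm_cst.
under eq_fun do rewrite big_cons.
by case: (P i) => //; exact: bm_add.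
Qed.

Lemma bm_prod (I : Type) (r : seq I) (P : pred I) (F : I -> T -> R) :
  (forall i, bounded_measurable (F i)) ->
  bounded_measurable (fun x => \prod_(i <- r | P i) F i x).
Proof.
move=> bF; elim: r => [|i r IHr].
  by under eq_fun do rewrite big_nil; exact: bm_cst.
under eq_fun do rewrite big_cons.
by case: (P i) => //; exact: bm_mul.
Qed.

Lemma bm_comp d' (T' : measurableType d') (g : T' -> T) f :
  measurable_fun setT g -> bounded_measurable f -> bounded_measurable (f \o g).
Proof.
move=> mg [mf [c fc]]; split; first exact: measurableT_comp.
by exists c => x /=.
Qed.

Lemma bm_integrable (P : probability T R) f : bounded_measurable f ->
  P.-integrable setT (EFin \o f).
Proof.
move=> [mf [c fc]]; apply: measurable_bounded_integrable => //.
  by rewrite [X in (X < _)%E]probability_setT ltry.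
exists c; split; first by rewrite num_real.
by move=> y cy x _ /=; rewrite (le_trans (fc x))// ltW.
Qed.

End bounded_measurable.

Section field_mean.
Context (R : realType) (mu : probability (measurableTypeR R) R).
Notation field n := (n.-tuple (measurableTypeR R)).

Lemma field_meanE n (f : field n -> R) :
  field_mean mu f = (\int[iid_law mu n]_h f h).
Proof. by rewrite /field_mean unlock. Qed.

Lemma meanE (f : R -> R) : mean mu f = (\int[mu]_x f x).
Proof. by rewrite /mean unlock. Qed.

Lemma field_mean_cst n c : field_mean mu (fun _ : field n => c) = c.
Proof. by rewrite field_meanE Rintegral_cst// [X in fine X]probability_setT mulr1. Qed.

Lemma field_meanD n (f g : field n -> R) :
  bounded_measurable f -> bounded_measurable g ->
  field_mean mu (fun h => f h + g h) = field_mean mu f + field_mean mu g.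
Proof. by move=> bf bg; rewrite !field_meanE RintegralD//; exact: bm_integrable. Qed.

Lemma field_meanZ n c (f : field n -> R) : bounded_measurable f ->
  field_mean mu (fun h => c * f h) = c * field_mean mu f.
Proof. by move=> bf; rewrite !field_meanE RintegralZl//; exact: bm_integrable. Qed.

Lemma field_mean_sum n (I : Type) (r : seq I) (P : pred I)
    (F : I -> field n -> R) : (forall i, bounded_measurable (F i)) ->
  field_mean mu (fun h => \sum_(i <- r | P i) F i h) =
  \sum_(i <- r | P i) field_mean mu (F i).
Proof.
move=> bF; elim: r => [|i r IHr].
  by under eq_fun do rewrite big_nil; rewrite field_mean_cst big_nil.
under eq_fun do rewrite big_cons; rewrite big_cons.
case: (P i) => //; rewrite field_meanD ?IHr//; exact: bm_sum.
Qed.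

Lemma le_field_mean n (f g : field n -> R) :
  bounded_measurable f -> bounded_measurable g -> (forall h, f h <= g h) ->
  field_mean mu f <= field_mean mu g.
Proof.
by move=> bf bg fg; rewrite !field_meanE le_Rintegral//; exact: bm_integrable.
Qed.

Lemma measurable_cons_field n (x : measurableTypeR R) :
  measurable_fun setT (fun t : field n => [tuple of x :: t]).
Proof.
exact: (measurableT_comp (measurable_cons_pair (n:=n)) (measurable_pair1 x)).
Qed.

(** Fubini, along the recursion that defines the product law. *)
Lemma field_mean_cons n (f : field n.+1 -> R) : bounded_measurable f ->
  field_mean mu f =
  mean mu (fun x => field_mean mu (fun t : field n => f [tuple of x :: t])).
Proof.
move=> bf; rewrite field_meanE meanE /Rintegral /=.
have mf : measurable_fun setT (EFin \o f) by apply/measurable_EFinP; case: bf.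
have bfc : bounded_measurable (f \o @cons_pair _ (measurableTypeR R) n).
  by apply: bm_comp => //; exact: measurable_cons_pair.
rewrite (integral_distribution (X := @cons_pair _ (measurableTypeR R) n))//; last first.
  exact: (bm_integrable _ bfc).
rewrite -(integral12_prod_meas1 (bm_integrable _ bfc)).
congr fine; apply: eq_integral => x _; rewrite /fubini_F field_meanE /Rintegral fineK//.
apply: integrable_fin_num => //.
by apply: (bm_integrable _ (bm_comp (@measurable_cons_field n x) bf)).
Qed.

Lemma eq_mean (f g : R -> R) : f =1 g -> mean mu f = mean mu g.
Proof. by move=> /funext->. Qed.

(** Independence of a coordinate from the others, by induction on [n]: the head
    coordinate is split off by Fubini, and a later one is treated inside the
    integral over the tail. *)
Lemma field_mean_indep n (i : 'I_n) (phi : R -> R) (G : field n -> R) :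
  @bounded_measurable R _ (measurableTypeR R) phi -> bounded_measurable G ->
  (forall h h' : field n, (forall j, j != i -> tnth h j = tnth h' j) ->
    G h = G h') ->
  field_mean mu (fun h => phi (tnth h i) * G h) =
  mean mu phi * field_mean mu G.
Proof.
move=> bphi; elim: n => [|n IHn] in i G *; first by case: i.
move=> bG indG.
have bphi1 : bounded_measurable (fun h : field n.+1 => phi (tnth h i)).
  exact: (bm_comp (measurable_tnth i) bphi).
rewrite field_mean_cons; last exact: bm_mul.
rewrite (field_mean_cons bG).
have bGx x : bounded_measurable (fun t : field n => G [tuple of x :: t]).
  exact: (bm_comp (@measurable_cons_field n x) bG).
case: (unliftP ord0 i) => [j|] iE; rewrite {}iE in indG bphi1 *.
  have ih x : field_mean mu (fun t : field n =>
        phi (tnth [tuple of x :: t] (lift ord0 j)) * G [tuple of x :: t]) =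
      mean mu phi * field_mean mu (fun t : field n => G [tuple of x :: t]).
    under eq_fun do rewrite tnthS.
    apply: IHn => // h h' hh'; apply: indG => l.
    case: (unliftP ord0 l) => [l'|] ->; last by [].
    by rewrite !tnthS => lj; apply: hh'; apply: contraNneq lj => ->.
  rewrite (eq_mean ih) !meanE RintegralZl//.
  have [mG [c Gc]] := bG.
  apply: bm_integrable; split; last first.
    exists c => x; rewrite field_meanE.
    apply: (le_trans (le_normr_Rintegral _ _)) => //.
      exact: (bm_integrable _ (bGx x)).
    rewrite -[leRHS](field_mean_cst n c) field_meanE le_Rintegral//.
      apply: (@bm_integrable R _ (field n)).
      have [mGx [c' Gxc]] := bGx x; split; first exact: measurableT_comp.
      by exists c' => t; rewrite normr_id.
    exact: (@bm_integrable R _ (field n) _ _ (bm_cst _ _)).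
  have bfc : bounded_measurable (G \o @cons_pair _ (measurableTypeR R) n).
    by apply: bm_comp => //; exact: measurable_cons_pair.
  have := measurable_fubini_F (bm_integrable (mu \x iid_law mu n)%E bfc).
  move=> /(measurableT_comp (fine_measurable (@measurableT _ (\bar R)))).
  apply: eq_measurable_fun => x _ /=.
  by rewrite field_meanE.
have G0 x x' (t : field n) : G [tuple of x :: t] = G [tuple of x' :: t].
  apply: indG => l; case: (unliftP ord0 l) => [l'|] ->; last by [].
  by rewrite !tnthS.
have e0 x : field_mean mu (fun t : field n =>
        phi (tnth [tuple of x :: t] ord0) * G [tuple of x :: t]) =
      phi x * field_mean mu (fun t : field n => G [tuple of 0 :: t]).
  rewrite -field_meanZ//; congr field_mean; apply/funext => t.
  by rewrite (G0 x 0) tnth0.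
have e1 x : field_mean mu (fun t : field n => G [tuple of x :: t]) =
      field_mean mu (fun t : field n => G [tuple of 0 :: t]).
  by congr field_mean; apply/funext => t; exact: G0.
rewrite (eq_mean e0) (eq_mean e1) !meanE RintegralZr//; last first.
  exact: (@bm_integrable R _ (measurableTypeR R)).
by rewrite Rintegral_cst// [X in fine X]probability_setT mulr1.
Qed.

Lemma field_mean_prod n (A : {set 'I_n}) (g : 'I_n -> R -> R) :
  (forall i, @bounded_measurable R _ (measurableTypeR R) (g i)) ->
  field_mean mu (fun h : field n => \prod_(i in A) g i (tnth h i)) =
  \prod_(i in A) mean mu (g i).
Proof.
move=> bg; elim: {A}#|A| {-2}A (erefl #|A|) => [|k IHk] A cA.
  rewrite (cards0_eq cA).
  by under eq_fun do rewrite big_set0; rewrite field_mean_cst big_set0.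
have /card_gt0P[i iA] : (0 < #|A|)%N by rewrite cA.
under eq_fun do rewrite (big_setD1 i iA) /=.
rewrite (big_setD1 i iA) /= -IHk; last first.
  by have := cardsD1 i A; rewrite iA cA => -[].
rewrite (field_mean_indep (bg i))//.
  by apply: bm_prod => j; exact: (bm_comp (measurable_tnth j) (bg j)).
move=> h h' hh'; apply: eq_bigr => j.
by rewrite in_setD1 => /andP[ji _]; rewrite hh'.
Qed.

Lemma field_mean_prodT n (g : 'I_n -> R -> R) :
  (forall i, @bounded_measurable R _ (measurableTypeR R) (g i)) ->
  field_mean mu (fun h : field n => \prod_i g i (tnth h i)) =
  \prod_i mean mu (g i).
Proof.
move=> /(field_mean_prod [set: 'I_n]%SET).
rewrite (eq_bigl xpredT) => [<-|i]; last by rewrite finset.in_setT.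
congr field_mean; apply/funext => h.
by apply: eq_bigl => i; rewrite finset.in_setT.
Qed.

End field_mean.

(** * Finite product measures *)

Section product_mean.
Context (R : realFieldType) (I T : finType).
Implicit Types (P f : I -> T -> R) (F G : {ffun I -> T} -> R).

(** Expectation of [F] when the coordinates are independent and the [i]-th one
    has law [P i].  It serves at two levels: a configuration with independent
    spins, and a sample of independent configurations. *)
Definition product_mean P F : R :=
  \sum_(x : {ffun I -> T}) (\prod_i P i (x i)) * F x.

Lemma product_meanD P F G :
  product_mean P (fun x => F x + G x) = product_mean P F + product_mean P G.
Proof. by rewrite /product_mean -big_split; apply: eq_bigr => x _; rewrite mulrDr. Qed.

Lemma product_meanZ P c F :
  product_mean P (fun x => c * F x) = c * product_mean P F.
Proof. by rewrite /product_mean mulr_sumr; apply: eq_bigr => x _; rewrite mulrCA. Qed.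

Lemma product_mean_sum P (J : finType) (A : pred J) (F : J -> {ffun I -> T} -> R) :
  product_mean P (fun x => \sum_(j | A j) F j x) =
  \sum_(j | A j) product_mean P (F j).
Proof.
by rewrite /product_mean exchange_big; apply: eq_bigr => x _; rewrite mulr_sumr.
Qed.

Lemma eq_product_mean P F G : F =1 G -> product_mean P F = product_mean P G.
Proof. by move=> FG; apply: eq_bigr => x _; rewrite FG. Qed.

Lemma le_product_mean P F G : (forall i t, 0 <= P i t) ->
  (forall x, F x <= G x) -> product_mean P F <= product_mean P G.
Proof.
by move=> P0 FG; apply: ler_sum => x _; rewrite ler_wpM2l ?prodr_ge0.
Qed.

Lemma product_mean_prod P f :
  product_mean P (fun x => \prod_i f i (x i)) =
  \prod_i \sum_t P i t * f i t.
Proof.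
by rewrite bigA_distr_bigA /=; apply: eq_bigr => x _; rewrite big_split.
Qed.

Section probability.
Variable P : I -> T -> R.
Hypothesis P1 : forall i, \sum_t P i t = 1.

Lemma product_mean_cst c : product_mean P (fun=> c) = c.
Proof.
rewrite /product_mean -mulr_suml -bigA_distr_bigA/=.
by rewrite big1 ?mul1r// => i _; exact: P1.
Qed.

Lemma product_mean_coord2 i j (f g : T -> R) : i != j ->
  product_mean P (fun x => f (x i) * g (x j)) =
  (\sum_t P i t * f t) * (\sum_t P j t * g t).
Proof.
move=> ij; pose h l := if l == i then f else if l == j then g else fun=> 1.
have hE (F : I -> (T -> R) -> R) : \prod_l F l (h l) =
    F i f * (F j g * \prod_(l | (l != i) && (l != j)) F l (fun=> 1)).
  rewrite (bigD1 i)//= (bigD1 j) 1?eq_sym//= /h eqxx (eq_sym j i) (negbTE ij) eqxx.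
  by do 2!congr (_ * _); apply: eq_bigr => l /andP[/negbTE-> /negbTE->].
under eq_product_mean => x.
  (* The other coordinates contribute factors 1 to a full product. *)
  rewrite -[g _]mulr1 -[in X in g _ * X](@big1_eq _ 1 *%R I (index_enum I)
    (fun l => (l != i) && (l != j))).
  rewrite -(hE (fun l u => u (x l))).
  over.
rewrite product_mean_prod (hE (fun l u => \sum_t P l t * u t)).
rewrite [X in _ * (_ * X)]big1 ?mulr1//.
by move=> l _; under eq_bigr do rewrite mulr1; exact: P1.
Qed.

Lemma product_mean_coord i (f : T -> R) :
  product_mean P (fun x => f (x i)) = \sum_t P i t * f t.
Proof.
pose h l := if l == i then f else fun=> 1.
have hE (F : I -> (T -> R) -> R) :
    \prod_l F l (h l) = F i f * \prod_(l | l != i) F l (fun=> 1).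
  rewrite (bigD1 i)//= /h eqxx.
  by congr (_ * _); apply: eq_bigr => l /negbTE->.
under eq_product_mean => x.
  rewrite -[f _]mulr1 -[in X in f _ * X](@big1_eq _ 1 *%R I (index_enum I)
    (fun l => l != i)).
  rewrite -(hE (fun l u => u (x l))).
  over.
rewrite product_mean_prod (hE (fun l u => \sum_t P l t * u t)) [X in _ * X]big1 ?mulr1//.
by move=> l _; under eq_bigr do rewrite mulr1; exact: P1.
Qed.

Lemma product_mean_sqr_sum (A : pred I) f :
  product_mean P (fun x => (\sum_(i | A i) f i (x i)) ^+ 2) =
  \sum_(i | A i) (\sum_t P i t * f i t ^+ 2 - (\sum_t P i t * f i t) ^+ 2) +
  (\sum_(i | A i) \sum_t P i t * f i t) ^+ 2.
Proof.
pose e i := \sum_t P i t * f i t.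
under eq_product_mean do rewrite expr2 mulr_suml.
rewrite product_mean_sum expr2 mulr_suml -big_split /=; apply: eq_bigr => i iA.
under eq_product_mean do rewrite mulr_sumr.
rewrite product_mean_sum mulr_sumr (bigD1 i)//= [in RHS](bigD1 i)//= addrA.
congr (_ + _).
  rewrite -expr2 subrK -(product_mean_coord i (fun t => f i t ^+ 2)).
  exact: eq_product_mean.
apply: eq_bigr => j /andP[_ ji].
by rewrite (product_mean_coord2 (f i) (f j))// eq_sym.
Qed.

Lemma product_mean_chebyshev f c : (forall i t, 0 <= P i t) ->
  (forall i, \sum_t P i t * f i t = 0) -> 0 < c ->
  product_mean P (fun x => (c <= `|\sum_i f i (x i)|)%R%:R) <=
  (\sum_i \sum_t P i t * f i t ^+ 2) / c ^+ 2.
Proof.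
move=> P0 f0 c0.
have -> : \sum_i \sum_t P i t * f i t ^+ 2 =
    product_mean P (fun x => (\sum_i f i (x i)) ^+ 2).
  rewrite product_mean_sqr_sum [X in _ + X ^+ 2]big1// expr0n/= addr0.
  by apply: eq_bigr => i _; rewrite f0 expr0n/= subr0.
rewrite ler_pdivlMr ?exprn_gt0// mulrC -product_meanZ.
apply: le_product_mean => // x.
have [cx|_] := leP c; last by rewrite mulr0 sqr_ge0.
by rewrite mulr1 -[leRHS]real_normK ?num_real// lerXn2r// nnegrE ltW.
Qed.

End probability.
End product_mean.

Section centring.
Context (R : realFieldType) (T : finType) (p : T -> R).
Hypothesis p1 : \sum_t p t = 1.

Lemma mean_centred (g : T -> R) c :
  \sum_t p t * (g t - c) = \sum_t p t * g t - c.
Proof.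
under eq_bigr do rewrite mulrBr.
by rewrite big_split/= sumrN -mulr_suml p1 mul1r.
Qed.

(** A variable with values in [[0, M]] has variance at most [M ^+ 2] whatever
    its law, so that a lower bound on its mean alone controls the lower tail of
    a sample average. *)
Lemma iid_lower_tail (m : nat) (g : T -> R) (M e d : R) :
  (0 < m)%N -> (forall t, 0 <= p t) -> (forall t, 0 <= g t <= M) ->
  0 < d -> e + d <= \sum_t p t * g t ->
  product_mean (fun=> p)
    (fun x : {ffun 'I_m -> T} => (m%:R^-1 * \sum_j g (x j) <= e)%R%:R) <=
  M ^+ 2 / (m%:R * d ^+ 2).
Proof.
move=> m0 p0 gM d0 ed; set c := \sum_t p t * g t in ed.
have m0' : 0 < m%:R :> R by rewrite ltr0n.
have M0 (t : T) : 0 <= M by have /andP[g0 gtM] := gM t; exact: le_trans gtM.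
have cM : c <= M.
  rewrite -[leRHS]mul1r -p1 mulr_suml; apply: ler_sum => t _.
  by apply: ler_wpM2l => //; have /andP[] := gM t.
have c0 : 0 <= c.
  by apply: sumr_ge0 => t _; rewrite mulr_ge0//; have /andP[] := gM t.
pose f (_ : 'I_m) t := g t - c.
have f0 i : \sum_t p t * f i t = 0 by rewrite mean_centred subrr.
have := product_mean_chebyshev (fun=> p1) (fun=> p0) f0 (mulr_gt0 m0' d0).
have vf : (\sum_(i < m) \sum_t p t * f i t ^+ 2) / (m%:R * d) ^+ 2 <=
    M ^+ 2 / (m%:R * d ^+ 2).
  have -> : M ^+ 2 / (m%:R * d ^+ 2) = (\sum_(i < m) M ^+ 2) / (m%:R * d) ^+ 2.
    rewrite sumr_const card_ord -[in RHS]mulr_natl; field.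
    by rewrite !gt_eqF.
  rewrite ler_wpM2r ?invr_ge0 ?sqr_ge0//; apply: ler_sum => i _.
  rewrite -[leRHS]mul1r -p1 mulr_suml; apply: ler_sum => t _.
  apply: ler_wpM2l => //.
  rewrite -[leLHS]real_normK ?num_real// lerXn2r ?nnegrE ?(M0 t)//.
  rewrite /f ler_norml; have /andP[g0 gtM] := gM t.
  by move: c0 cM g0 gtM; clear; lra.
move=> /le_trans/(_ vf); apply: le_trans.
apply: le_product_mean => // x.
have [le_e|_] := leP (_ * _) e; last by rewrite ler0n.
suff -> : (m%:R * d <= `|\sum_i f i (x i)|)%R by [].
have -> : \sum_i f i (x i) = \sum_j g (x j) - m%:R * c.
  by rewrite /f sumrB sumr_const card_ord mulr_natl.
rewrite -normrN; apply: le_trans (ler_norm _).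
have xe : \sum_j g (x j) <= m%:R * e by rewrite -ler_pdivrMl.
have edc : m%:R * (e + d) <= m%:R * c by rewrite ler_wpM2l// ltW.
by move: xe edc; clear; lra.
Qed.

End centring.

(** * Fair spins *)

Section cosh.
Variable R : realType.

Lemma sinh_le_mul_cosh (x : R) : 0 <= x ->
  expR x - expR (- x) <= x * (expR x + expR (- x)).
Proof.
move=> x0; pose e : R -> R := expR \o -%R.
pose f : R -> R := id * (expR + e) - (expR - e).
have df (y : R) : is_derive y 1 f (y * (expR y - expR (- y))).
  apply: is_derive_eq; rewrite /GRing.scale/= /e/=.
  by rewrite -[(expR + _) y]/(expR y + expR (- y)); ring.
have fE y : f y = y * (expR y + expR (- y)) - (expR y - expR (- y)) by [].
suff : f 0 <= f x by rewrite !fE mul0r oppr0 subrr subr0 subr_ge0.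
apply: (ger0_derive1_ndecry (a := 0)) => //.
- move=> y; rewrite in_itv/= andbT => y0.
  rewrite derive1E (@derive_val _ _ _ _ _ _ _ (df y)).
  by rewrite mulr_ge0 ?ltW// subr_gt0 ltr_expR gtrN.
- by apply: continuous_subspaceT => z; apply: differentiable_continuous;
  apply/derivable1_diffP; apply: ex_derive; exact: df.
Qed.

(** The quotient of the two sides is monotone on each half-line because
    [sinh x <= x cosh x] for [0 <= x]. *)
Lemma cosh_le_expR_sqr (x : R) : (expR x + expR (- x)) / 2 <= expR (x ^+ 2 / 2).
Proof.
wlog x0 : x / 0 <= x => [h|].
  have [/h//|x0] := leP 0 x.
  by rewrite -sqrrN addrC -[in expR x](opprK x) h// oppr_ge0 ltW.
pose e : R -> R := expR \o -%R.
pose g : R -> R := cst (- 2^-1) * (id * id).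
pose f : R -> R := (expR \o g) * (expR + e).
have fE y : f y = expR (- 2^-1 * (y * y)) * (expR y + expR (- y)) by [].
have df (y : R) : is_derive y 1 f
    (expR (g y) * (expR y - expR (- y) - y * (expR y + expR (- y)))).
  apply: is_derive_eq; rewrite /GRing.scale/= /e/= /g/=.
  by rewrite -[(expR + _) y]/(expR y + expR (- y)); field.
suff : f x <= f 0.
  rewrite !fE !mulr0 oppr0 !expR0 mul1r mulNr (expRN (2^-1 * _)) mulrC.
  rewrite ler_pdivrMr ?expR_gt0//.
  rewrite -expr2 [2^-1 * _]mulrC; lra.
apply: (@ler0_derive1_le_cc _ f 0 x) => //.
- move=> y; rewrite in_itv/= => /andP[y0 _].
  rewrite derive1E (@derive_val _ _ _ _ _ _ _ (df y)).
  by rewrite mulr_ge0_le0 ?expR_ge0// subr_le0 sinh_le_mul_cosh// ltW.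
- by apply: continuous_subspaceT => z; apply: differentiable_continuous;
  apply/derivable1_diffP; apply: ex_derive; exact: df.
- by rewrite in_itv/= x0 lexx.
- by rewrite in_itv/= lexx x0.
Qed.

End cosh.

Section spins.
Context (R : realType) (n : nat).
Implicit Types (s t eta : config n) (A S : {set 'I_n}) (F G : config n -> R).

Definition spin_sum A s : R := \sum_(i in A) spin R s i.

(** The configuration [eta] marks the sites whose spin is reversed. *)
Definition twist eta s : config n := [ffun i => s i (+) eta i].

Definition uniform_mean F : R := product_mean (fun _ _ => 2^-1) F.

Lemma twistK eta : involutive (twist eta).
Proof. by move=> s; apply/ffunP => i; rewrite !ffunE -addbA addbb addbF. Qed.

Lemma twistC s eta : twist eta s = twist s eta.
Proof. by apply/ffunP => i; rewrite !ffunE addbC. Qed.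

Lemma spin_twist eta s i :
  spin R (twist eta s) i = if eta i then - spin R s i else spin R s i.
Proof. by rewrite /spin ffunE; case: (s i); case: (eta i); rewrite //= opprK. Qed.

Lemma spin_sqr s i : spin R s i ^+ 2 = 1.
Proof. by rewrite /spin; case: (s i); rewrite ?sqrrN expr1n. Qed.

Lemma uniform_weight1 (i : 'I_n) : \sum_(b : bool) 2^-1 = 1 :> R.
Proof. by rewrite big_bool /=; field. Qed.

Lemma uniform_mean_cst c : uniform_mean (fun=> c) = c.
Proof. exact/product_mean_cst/uniform_weight1. Qed.

Lemma uniform_meanD F G :
  uniform_mean (fun s => F s + G s) = uniform_mean F + uniform_mean G.
Proof. exact: product_meanD. Qed.

Lemma uniform_meanZ c F :
  uniform_mean (fun s => c * F s) = c * uniform_mean F.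
Proof. exact: product_meanZ. Qed.

Lemma eq_uniform_mean F G : F =1 G -> uniform_mean F = uniform_mean G.
Proof. exact: eq_product_mean. Qed.

Lemma le_uniform_mean F G : (forall s, F s <= G s) ->
  uniform_mean F <= uniform_mean G.
Proof. by apply: le_product_mean => _ _; rewrite invr_ge0. Qed.

Lemma uniform_mean_ge0 F : (forall s, 0 <= F s) -> 0 <= uniform_mean F.
Proof.
by move=> F0; rewrite -(uniform_mean_cst 0); exact: le_uniform_mean.
Qed.

Lemma uniform_meanE F : uniform_mean F = \sum_s 2^-1 ^+ n * F s.
Proof. by apply: eq_bigr => s _; rewrite prodr_const card_ord. Qed.

Lemma uniform_mean_twist eta F :
  uniform_mean (fun s => F (twist eta s)) = uniform_mean F.
Proof.
by rewrite !uniform_meanE [RHS](reindex_inj (inv_inj (twistK eta))).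
Qed.

(** Reversing the spin at [i] preserves the uniform law, so that spin may be
    averaged over its two values; the moments and the Laplace transform below
    follow by induction on the set of sites. *)
Lemma uniform_mean_spin_sumD1 A i (g : R -> R) : i \in A ->
  uniform_mean (fun s => g (spin_sum A s)) =
  uniform_mean (fun s => (g (spin_sum (A :\ i) s + 1) +
                          g (spin_sum (A :\ i) s - 1)) / 2).
Proof.
move=> iA; pose e : config n := [ffun j => j == i].
have sA s : spin_sum A s = spin_sum (A :\ i) s + spin R s i.
  by rewrite /spin_sum (big_setD1 i iA) addrC.
have sAe s : spin_sum A (twist e s) = spin_sum (A :\ i) s - spin R s i.
  rewrite sA spin_twist ffunE eqxx; congr (_ + _); apply: eq_bigr => j.
  by rewrite in_setD1 spin_twist ffunE => /andP[/negbTE->].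
transitivity ((uniform_mean (fun s => g (spin_sum A s)) +
    uniform_mean (fun s => g (spin_sum A (twist e s)))) / 2).
  by rewrite (uniform_mean_twist e (fun s => g (spin_sum A s))); field.
rewrite -uniform_meanD mulrC -uniform_meanZ; apply: eq_uniform_mean => s.
rewrite sA sAe mulrC /spin; case: (s i) => //.
by rewrite opprK [g _ + _]addrC.
Qed.

Lemma spin_sum_moments A : let k : R := #|A|%:R in
  [/\ uniform_mean (spin_sum A) = 0,
      uniform_mean (fun s => spin_sum A s ^+ 2) = k,
      uniform_mean (fun s => spin_sum A s ^+ 3) = 0,
      uniform_mean (fun s => spin_sum A s ^+ 4) = 3 * k ^+ 2 - 2 * k &
      uniform_mean (fun s => spin_sum A s ^+ 6) =
        15 * k ^+ 3 - 30 * k ^+ 2 + 16 * k].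
Proof.
elim: {A}#|A| {-2}A (erefl #|A|) => [|k IHk] A cA /=.
  rewrite cA (cards0_eq cA).
  by split; under eq_uniform_mean do rewrite /spin_sum big_set0 ?expr0n;
    rewrite uniform_mean_cst /=; ring.
have /card_gt0P[i iA] : (0 < #|A|)%N by rewrite cA.
have cA' : #|A :\ i| = k by have := cardsD1 i A; rewrite iA cA => -[].
have [] := IHk _ cA'; rewrite cA cA'; set T := spin_sum (A :\ i).
move=> M1 M2 M3 M4 M6.
have step (g h : R -> R) : (forall x, (g (x + 1) + g (x - 1)) / 2 = h x) ->
    uniform_mean (fun s => g (spin_sum A s)) = uniform_mean (fun s => h (T s)).
  move=> gh; rewrite (uniform_mean_spin_sumD1 _ iA); apply: eq_uniform_mean => s.
  exact: gh.
split.
- by rewrite (step id id) // => x; field.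
- rewrite (step (fun x => x ^+ 2) (fun x => x ^+ 2 + 1)) => [|x]; last by field.
  by rewrite uniform_meanD M2 uniform_mean_cst -natr1.
- rewrite (step (fun x => x ^+ 3) (fun x => x ^+ 3 + 3 * x)) => [|x]; last by field.
  by rewrite uniform_meanD uniform_meanZ M1 M3; ring.
- rewrite (step (fun x => x ^+ 4) (fun x => x ^+ 4 + (6 * x ^+ 2 + 1))) => [|x]; last by field.
  rewrite !uniform_meanD uniform_meanZ M4 M2 uniform_mean_cst -natr1; ring.
- pose g (x : R) := x ^+ 6 + (15 * x ^+ 4 + (15 * x ^+ 2 + 1)).
  rewrite (step (fun x => x ^+ 6) g) => [|x]; last by rewrite /g; field.
  rewrite /g.
  rewrite !uniform_meanD !uniform_meanZ M6 M4 M2 uniform_mean_cst -natr1; ring.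
Qed.

(** Induction on [A]: averaging over one sign replaces [l] by [l + 2 l^2] and
    [|A|] by [|A| - 1], and [(1 - 2 l) exp(2 l) <= 1] absorbs the difference.
    This is the bound [(1 - 2 l |A|)^(-1/2)] on the Laplace transform of the
    square, which is an equality for a Gaussian of variance [|A|]; it is stated
    for the square of the transform to stay free of roots. *)
Lemma spin_sum_sqr_mgf A (l : R) : 0 <= l -> 2 * l * #|A|%:R < 1 ->
  uniform_mean (fun s => expR (l * spin_sum A s ^+ 2)) ^+ 2 *
    (1 - 2 * l * #|A|%:R) <= 1.
Proof.
elim: {A}#|A| {-2}A (erefl #|A|) l => [|k IHk] A cA l l0.
  rewrite cA (cards0_eq cA) mulr0 subr0 mulr1 => _.
  under eq_uniform_mean do rewrite /spin_sum big_set0 expr0n mulr0 expR0.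
  by rewrite uniform_mean_cst expr1n.
have /card_gt0P[i iA] : (0 < #|A|)%N by rewrite cA.
have cA' : #|A :\ i| = k by have := cardsD1 i A; rewrite iA cA => -[].
rewrite cA -(natr1 k) => lk1.
have k0 : 0 <= k%:R :> R by rewrite ler0n.
pose l' := l + 2 * l ^+ 2.
have l'0 : 0 <= l' by rewrite /l'; nra.
have lk0 : 0 <= l * k%:R by rewrite mulr_ge0.
have l'k : 2 * l' * k%:R < 1.
  rewrite /l'.
  have h1 : 2 * l * k%:R * (1 + 2 * l) <= (1 - 2 * l) * (1 + 2 * l).
    by apply: ler_wpM2r; lra.
  have [l00|lpos] := eqVneq l 0; first by rewrite l00; lra.
  have : 0 < l ^+ 2 by rewrite exprn_gt0// lt_neqAle eq_sym lpos.
  by nra.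
have := IHk _ cA' l' l'0; rewrite cA' => /(_ l'k).
set E' := uniform_mean _; set E := uniform_mean _ => IH.
have EE' : E <= expR l * E'.
  rewrite /E /E' (@uniform_mean_spin_sumD1 A i (fun x => expR (l * x ^+ 2)))//.
  rewrite -uniform_meanZ; apply: le_uniform_mean => s; set T := spin_sum _ _.
  have -> : l * (T + 1) ^+ 2 = l + l * T ^+ 2 + 2 * l * T by ring.
  have -> : l * (T - 1) ^+ 2 = l + l * T ^+ 2 + - (2 * l * T) by ring.
  rewrite !(expRD (l + _)) -mulrDr -mulrA.
  apply: (@le_trans _ _ (expR (l + l * T ^+ 2) * expR ((2 * l * T) ^+ 2 / 2))).
    by rewrite ler_wpM2l ?expR_ge0// cosh_le_expR_sqr.
  rewrite -!expRD.
  have -> : l + l * T ^+ 2 + (2 * l * T) ^+ 2 / 2 = l + l' * T ^+ 2.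
    by rewrite /l'; field.
  by [].
have E0 : 0 <= E.
  by apply: uniform_mean_ge0 => s; exact: expR_ge0.
have E'0 : 0 <= E'.
  by apply: uniform_mean_ge0 => s; exact: expR_ge0.
have e2 : expR l ^+ 2 * (1 - 2 * l) <= 1.
  have : 1 - 2 * l <= expR (- (2 * l)) by exact: expR_ge1Dx.
  by rewrite expRN expRM_natl -ler_pdivlMl ?exprn_gt0 ?expR_gt0// mulr1.
have le1 : 1 - 2 * l * (k%:R + 1) <= (1 - 2 * l) * (1 - 2 * l' * k%:R).
  have : 0 <= l ^+ 3 * k%:R by rewrite mulr_ge0 ?exprn_ge0.
  by rewrite /l'; nra.
apply: (@le_trans _ _ ((expR l * E') ^+ 2 * ((1 - 2 * l) * (1 - 2 * l' * k%:R)))).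
  apply: ler_pM; rewrite ?sqr_ge0//; first lra.
  by rewrite lerXn2r ?nnegrE// mulr_ge0 ?expR_ge0.
rewrite exprMn mulrACA -[leRHS]mulr1; apply: ler_pM => //.
- by rewrite mulr_ge0 ?sqr_ge0//; nra.
- by rewrite mulr_ge0 ?sqr_ge0//; lra.
Qed.

End spins.

(** * Exponential tilting *)

Section tilting.
Context (R : realType) (T : finType) (p : T -> R).
Hypotheses (p0 : forall t, 0 <= p t) (p1 : \sum_t p t = 1).

(** Chebyshev's association inequality, by symmetrization over two independent
    draws [s] and [t].  The hypothesis says that [f] and [w / g] are monotone in
    the same sense; the conclusion compares the means of [f] under the laws
    tilted by [w] and by [g]. *)
Lemma association (f g w : T -> R) :
  (forall s t, 0 <= (f s - f t) * (w s * g t - g s * w t)) ->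
  (\sum_t p t * (f t * g t)) * (\sum_t p t * w t) <=
  (\sum_t p t * (f t * w t)) * (\sum_t p t * g t).
Proof.
move=> fgw; rewrite -subr_ge0.
set A := \sum_t p t * (f t * w t); set B := \sum_t p t * g t.
set C := \sum_t p t * (f t * g t); set D := \sum_t p t * w t.
suff : 0 <= (A * B + B * A) - (C * D + D * C) by lra.
rewrite !big_distrlr/= -!big_split/= -sumrB; apply: sumr_ge0 => s _.
rewrite -!big_split/= -sumrB; apply: sumr_ge0 => t _.
have := mulr_ge0 (mulr_ge0 (p0 s) (p0 t)) (fgw s t).
by congr (0 <= _); ring.
Qed.

Section quadratic_gain.
Variables (U : T -> R) (theta t M : R).
Hypotheses (U0 : forall s, 0 <= U s) (t0 : 0 <= t) (t_theta : t <= theta / 2).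
Hypothesis M0 : 0 < M.

Let m j := \sum_s p s * U s ^+ j.
Let f s := Num.min (U s) M.
Let w s := expR (theta / 2 * U s).
Let g s := 1 + t * U s.

Lemma moment_association i j : m i * m j <= m (i + j).
Proof.
have h s s' : 0 <= (U s ^+ i - U s' ^+ i) * (U s ^+ j * 1 - 1 * U s' ^+ j).
  rewrite mulr1 mul1r; have [|/ltW] := leP (U s) (U s') => le_U.
    by rewrite mulr_le0// subr_le0 lerXn2r ?nnegrE.
  by rewrite mulr_ge0// subr_ge0 lerXn2r ?nnegrE.
have := association h.
rewrite [X in _ <= _ * X](eq_bigr p) => [|s _]; last by rewrite mulr1.
rewrite p1 mulr1 /m.
under eq_bigr do rewrite mulr1.
by under [in X in _ <= X]eq_bigr do rewrite -exprD.
Qed.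

(** [expR (theta / 2 * u) / (1 + t * u)] is nondecreasing in [u], by
    [1 + x <= expR x]. *)
Lemma exp_tilt_ge_linear_tilt :
  (\sum_s p s * (f s * g s)) * (\sum_s p s * w s) <=
  (\sum_s p s * (f s * w s)) * (\sum_s p s * g s).
Proof.
apply: association => s s'.
have mono u v : 0 <= v -> v <= u ->
    0 <= (Num.min u M - Num.min v M) *
         (expR (theta / 2 * u) * (1 + t * v) - (1 + t * u) * expR (theta / 2 * v)).
  move=> v0 vu; rewrite mulr_ge0 ?subr_ge0//.
    by rewrite le_min !ge_min vu lexx orbT.
  have -> : theta / 2 * u = theta / 2 * v + theta / 2 * (u - v) by ring.
  rewrite expRD; set ev := expR (theta / 2 * v).
  rewrite -[leRHS]mulrA [leLHS]mulrC ler_wpM2l ?expR_ge0//.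
  have tuv : 1 + t * (u - v) <= expR (theta / 2 * (u - v)).
    apply: le_trans (expR_ge1Dx _).
    by rewrite lerD2l ler_wpM2r// subr_ge0.
  apply: (@le_trans _ _ ((1 + t * (u - v)) * (1 + t * v))).
    have : 0 <= t * t * ((u - v) * v) by rewrite !mulr_ge0// subr_ge0.
    by lra.
  by rewrite ler_wpM2r// addr_ge0// mulr_ge0.
have [le_U|/ltW le_U] := leP (U s) (U s').
  have := mono _ _ (U0 s) le_U; congr (0 <= _); rewrite /f /w /g; ring.
exact: mono.
Qed.

(** Weakening the exponential tilt to [1 + t * U] makes the gain explicit: to
    first order in [t] the mean of [U] increases by [t] times its variance.
    The term in [t ^+ 2] bounds the effect of the normalization, and those in
    [M^-1] pay for the truncation through [U - U ^+ 2 / M <= Num.min U M]. *)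
Lemma truncated_tilt_ge :
  m 1 - m 2 / M + t * (m 2 - m 3 / M - m 1 ^+ 2) - t ^+ 2 * m 3 <=
  (\sum_s p s * (f s * w s)) / (\sum_s p s * w s).
Proof.
have W0 : 0 < \sum_s p s * w s.
  apply: (@lt_le_trans _ _ 1) => //; rewrite -p1; apply: ler_sum => s _.
  rewrite ler_peMr// -[leLHS]expR0 ler_expR mulr_ge0//.
  by apply: le_trans t_theta.
have m0 j : 0 <= m j.
  by apply: sumr_ge0 => s _; rewrite mulr_ge0// exprn_ge0.
have f_ge s : U s - U s ^+ 2 / M <= f s.
  rewrite /f le_min; apply/andP; split.
    by rewrite lerBlDr lerDl divr_ge0 ?sqr_ge0// ltW.
  rewrite -(ler_pM2r M0) mulrBl divfK ?gt_eqF//.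
  by have := sqr_ge0 (U s - M); have := sqr_ge0 (U s); have := sqr_ge0 M; nra.
have f_le s : f s <= U s by rewrite /f ge_min lexx.
have f_ge0 s : 0 <= f s by rewrite /f le_min U0 ltW.
set F1 := \sum_s p s * f s.
set FU := \sum_s p s * (f s * U s).
have m1E : m 1 = \sum_s p s * U s by apply: eq_bigr => s _; rewrite expr1.
have F1_ge : m 1 - m 2 / M <= F1.
  rewrite m1E /m mulr_suml -sumrB; apply: ler_sum => s _.
  by rewrite -mulrA -mulrBr ler_wpM2l.
have F1_le : F1 <= m 1 by rewrite m1E; apply: ler_sum => s _; rewrite ler_wpM2l.
have F1_ge0 : 0 <= F1 by apply: sumr_ge0 => s _; rewrite mulr_ge0.
have FU_ge : m 2 - m 3 / M <= FU.
  rewrite /m mulr_suml -sumrB; apply: ler_sum => s _.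
  rewrite -mulrA -mulrBr ler_wpM2l// [U s ^+ 3]exprSr mulrAC expr2 -mulrBl.
  by rewrite ler_wpM2r.
have FU_le : FU <= m 2.
  by apply: ler_sum => s _; rewrite ler_wpM2l// expr2 ler_wpM2r.
have GE : \sum_s p s * g s = 1 + t * m 1.
  rewrite m1E mulr_sumr -p1 -big_split/=; apply: eq_bigr => s _.
  by rewrite /g; ring.
have NE : \sum_s p s * (f s * g s) = F1 + t * FU.
  rewrite mulr_sumr -big_split/=; apply: eq_bigr => s _.
  by rewrite /g; ring.
have G0 : 0 < 1 + t * m 1 by rewrite ltr_pwDl// mulr_ge0.
have := exp_tilt_ge_linear_tilt; rewrite GE NE => tilt.
apply: (@le_trans _ _ ((F1 + t * FU) / (1 + t * m 1))); last first.
  by rewrite ler_pdivrMr// mulrAC ler_pdivlMr.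
rewrite ler_pdivlMr//.
apply: (@le_trans _ _ ((F1 + t * (FU - F1 * m 1) - t ^+ 2 * m 3) * (1 + t * m 1))).
  apply: ler_wpM2r; first exact: ltW.
  by rewrite lerD2r lerD// ler_wpM2l// lerB// expr2 ler_wpM2r.
(* The normalization costs [t * m 1] times the covariance, and the covariance
   is at most [m 2]. *)
have m12 : m 1 * m 2 <= m 3 := moment_association 1 2.
have h1 : m 1 * (FU - F1 * m 1) <= m 3.
  apply: le_trans m12; rewrite ler_wpM2l//.
  by rewrite lerBlDr (le_trans FU_le)// lerDl mulr_ge0.
have h2 : t ^+ 2 * (m 1 * (FU - F1 * m 1)) <= t ^+ 2 * m 3.
  by rewrite ler_wpM2l// sqr_ge0.
have h3 : 0 <= t ^+ 3 * (m 1 * m 3) by rewrite !mulr_ge0 ?exprn_ge0.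
rewrite -subr_ge0; set d := (X in 0 <= X).
have -> : d = t ^+ 3 * (m 1 * m 3) +
    (t ^+ 2 * m 3 - t ^+ 2 * (m 1 * (FU - F1 * m 1))) by rewrite /d; ring.
by rewrite addr_ge0// subr_ge0.
Qed.

End quadratic_gain.
End tilting.

(** * The null law *)

Section hyperbolic_facts.
Variable R : realType.
Implicit Types x : R.

Lemma cosh2_gt0 x : 0 < expR x + expR (- x).
Proof. by rewrite addr_gt0 ?expR_gt0. Qed.

Lemma sech_sqr x : sech x ^+ 2 = 1 - tanh x ^+ 2.
Proof.
have e : expR x * expR (- x) = 1 by rewrite -expRD subrr expR0.
rewrite /sech /tanh; have := lt0r_neq0 (cosh2_gt0 x).
set u := expR x in e *; set v := expR (- x) in e * => uv.
by transitivity (4 * (u * v) / (u + v) ^+ 2); [rewrite e; field | field].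
Qed.

Lemma tanh_itv x : -1 <= tanh x <= 1.
Proof.
rewrite /tanh ler_pdivlMr ?cosh2_gt0// ler_pdivrMr ?cosh2_gt0//.
by have := expR_gt0 x; have := expR_gt0 (- x); lra.
Qed.

Lemma bm_tanh : @bounded_measurable R _ (measurableTypeR R) (@tanh R).
Proof.
split; last by exists 1 => x; rewrite ler_norml tanh_itv.
have me : measurable_fun [set: R] (fun x : R => expR (- x)).
  exact: measurableT_comp.
have -> : @tanh R =
    fun x => (expR x - expR (- x)) * expR (- ln (expR x + expR (- x))).
  by apply/funext => x; rewrite (expRN (ln _)) lnK// posrE cosh2_gt0.
apply: measurable_funM; first exact: measurable_funB.
apply: measurableT_comp => //; apply: measurableT_comp => //.
by apply: measurableT_comp => //; exact: measurable_funD.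
Qed.

End hyperbolic_facts.

Section planted_model.
Context (R : realType) (mu : probability (measurableTypeR R) R) (n : nat).
Hypothesis tanh_mean0 : mean mu (@tanh R) = 0.
Notation field := (n.-tuple (measurableTypeR R)).
Implicit Types (s t e : config n) (S : {set 'I_n}) (h : field).

Let q := mean mu (fun x => tanh x ^+ 2).

(** The law of one spin with mean [r]. *)
Definition spin_prob (r : R) (b : bool) : R :=
  (1 + (if b then 1 else -1) * r) / 2.

Lemma spin_prob1 r : \sum_b spin_prob r b = 1.
Proof. by rewrite big_bool /spin_prob/=; field. Qed.

Lemma spin_prob_ge0 r b : -1 <= r <= 1 -> 0 <= spin_prob r b.
Proof. by rewrite /spin_prob; case: b; lra. Qed.

Lemma null_condE h s : null_cond h s = \prod_i spin_prob (tanh (tnth h i)) (s i).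
Proof.
rewrite /null_cond /normalized /null_weight /field_energy.
pose E i (b : bool) : R := expR (tnth h i * (if b then 1 else -1)).
have wE t : expR (\sum_i tnth h i * spin R t i) = \prod_i E i (t i).
  by rewrite expR_sum.
under [X in _ / X]eq_bigr do rewrite wE.
rewrite wE -(bigA_distr_bigA E) -prodf_div; apply: eq_bigr => i _.
have := gt_eqF (cosh2_gt0 (tnth h i)); rewrite /spin_prob /tanh /E big_bool/=.
rewrite mulr1 mulrN1 => uv.
by case: (s i); rewrite ?mulr1 ?mulrN1; field; rewrite uv.
Qed.

Lemma null_cond_ge0 h s : 0 <= null_cond h s.
Proof.
by rewrite null_condE prodr_ge0// => i _; rewrite spin_prob_ge0// tanh_itv.
Qed.

Lemma null_cond1 h : \sum_s null_cond h s = 1.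
Proof.
under eq_bigr do rewrite null_condE.
rewrite -(bigA_distr_bigA (fun i b => spin_prob (tanh (tnth h i)) b)).
by rewrite big1// => i _; exact: spin_prob1.
Qed.

Lemma bm_spin_prob b :
  @bounded_measurable R _ (measurableTypeR R) (fun x => spin_prob (tanh x) b).
Proof.
rewrite /spin_prob; apply: bm_mul (bm_cst _ _).
apply: bm_add; first exact: bm_cst.
by apply: bm_mul; [exact: bm_cst | exact: bm_tanh].
Qed.

Lemma bm_null_cond s : bounded_measurable (fun h => null_cond h s).
Proof.
under eq_fun do rewrite null_condE.
apply: bm_prod => i; exact: (bm_comp (measurable_tnth i) (bm_spin_prob (s i))).
Qed.

Lemma mean_affine (c d : R) (f : R -> R) :
  @bounded_measurable R _ (measurableTypeR R) f ->
  mean mu (fun x => c + d * f x) = c + d * mean mu f.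
Proof.
move=> bf; rewrite !meanE RintegralD//.
- by rewrite Rintegral_cst// [X in fine X]probability_setT mulr1 RintegralZl//;
    exact: bm_integrable.
- exact: (@bm_integrable R _ (measurableTypeR R) _ _ (bm_cst _ _)).
- exact: (@bm_integrable R _ (measurableTypeR R) _ _ (bm_mul (bm_cst _ _) bf)).
Qed.

Lemma mean_spin_prob b : mean mu (fun x => spin_prob (tanh x) b) = 2^-1.
Proof.
under eq_mean do rewrite /spin_prob mulrDl mul1r mulrAC.
by rewrite mean_affine ?tanh_mean0 ?mulr0 ?addr0//; exact: bm_tanh.
Qed.

Lemma mean_spin_prob2 b c :
  mean mu (fun x => spin_prob (tanh x) b * spin_prob (tanh x) c) =
  2^-1 * spin_prob (q * (if b then 1 else -1)) c.
Proof.
set u : R := if b then 1 else -1; set v : R := if c then 1 else -1.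
have bt2 : @bounded_measurable R _ (measurableTypeR R) (fun x => tanh x ^+ 2).
  by under eq_fun do rewrite expr2; apply: bm_mul; exact: bm_tanh.
have E x : spin_prob (tanh x) b * spin_prob (tanh x) c =
    (4^-1 + u * v / 4 * tanh x ^+ 2) + (u + v) / 4 * tanh x.
  by rewrite /spin_prob -/u -/v; field.
rewrite (eq_mean _ E) meanE RintegralD//.
- have := mean_affine 0 ((u + v) / 4) (@bm_tanh R).
  rewrite tanh_mean0 mulr0 addr0 meanE; under eq_Rintegral do rewrite add0r.
  move=> ->; rewrite addr0 -meanE mean_affine// -/q /spin_prob -/u -/v.
  by field.
- apply: (@bm_integrable R _ (measurableTypeR R)).
  by apply: bm_add; [exact: bm_cst | apply: bm_mul => //; exact: bm_cst].
- apply: (@bm_integrable R _ (measurableTypeR R)).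
  by apply: bm_mul; [exact: bm_cst | exact: bm_tanh].
Qed.

Lemma field_mean_null_cond s : field_mean mu (fun h => null_cond h s) = 2^-1 ^+ n.
Proof.
under eq_fun do rewrite null_condE.
rewrite (field_mean_prodT mu (g := fun i x => spin_prob (tanh x) (s i))); last first.
  by move=> i; exact: bm_spin_prob.
rewrite (eq_bigr (fun=> 2^-1)) => [|i _]; last exact: mean_spin_prob.
by rewrite prodr_const card_ord.
Qed.

Lemma field_mean_null_cond2 s t :
  field_mean mu (fun h => null_cond h s * null_cond h t) =
  2^-1 ^+ n * \prod_i spin_prob (q * spin R s i) (t i).
Proof.
under eq_fun do rewrite !null_condE -big_split/=.
rewrite (field_mean_prodT mu
  (g := fun i x => spin_prob (tanh x) (s i) * spin_prob (tanh x) (t i))); last first.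
  by move=> i; apply: bm_mul; exact: bm_spin_prob.
rewrite (eq_bigr (fun i => 2^-1 * spin_prob (q * spin R s i) (t i))).
  by rewrite big_split/= prodr_const card_ord.
by move=> i _; exact: mean_spin_prob2.
Qed.

Lemma null_lawE : null_law mu (n := n) = fun=> 2^-1 ^+ n.
Proof. by apply/funext => s; exact: field_mean_null_cond. Qed.

End planted_model.

(** * The planted law *)

Section planted_law.
Context (R : realType) (mu : probability (measurableTypeR R) R) (n : nat).
Hypothesis tanh_mean0 : mean mu (@tanh R) = 0.
Variables (theta : R) (S : {set 'I_n}).
Hypothesis theta0 : 0 <= theta.
Notation field := (n.-tuple (measurableTypeR R)).
Notation k := (#|S|%:R : R).
Implicit Types (s t e eta : config n) (h : field).

(** The normalization makes its mean 1 under the null law. *)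
Definition sqr_mag s : R := spin_sum R S s ^+ 2 / k.

Let tilt s := expR (theta / 2 * sqr_mag s).
Let partition h := \sum_t null_cond h t * tilt t.

Lemma sqr_mag_ge0 s : 0 <= sqr_mag s.
Proof. by rewrite divr_ge0 ?sqr_ge0. Qed.

Lemma spin_sum_twist (A : {set 'I_n}) eta s : {in A, forall i, eta i = false} ->
  spin_sum R A (twist eta s) = spin_sum R A s.
Proof. by move=> eA; apply: eq_bigr => i /eA ei; rewrite spin_twist ei. Qed.

Lemma planted_condE h s :
  planted_cond theta S h s = null_cond h s * tilt s / partition h.
Proof.
have wE t : planted_weight theta S h t = null_weight h t * tilt t.
  rewrite /planted_weight expRD mulrC; congr (_ * expR _).
  under eq_bigr do rewrite -mulr_sumr.
  by rewrite -mulr_suml -expr2 /sqr_mag /spin_sum invfM; ring.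
have sum0 (f : config n -> R) : (forall t, 0 < f t) -> \sum_t f t != 0.
  move=> f0; rewrite gt_eqF// (bigD1 [ffun=> true])//= ltr_pwDl//.
  by apply: sumr_ge0 => t _; exact: ltW.
have Z0 : \sum_t null_weight h t != 0 by apply: sum0 => t; exact: expR_gt0.
have N0 : \sum_t null_weight h t * tilt t != 0.
  by apply: sum0 => t; rewrite mulr_gt0 ?expR_gt0.
have pE : partition h = (\sum_t null_weight h t * tilt t) / \sum_t null_weight h t.
  by rewrite mulr_suml; apply: eq_bigr => t _; rewrite mulrAC.
rewrite pE /planted_cond /null_cond /normalized wE.
under eq_bigr do rewrite wE.
by field; rewrite Z0 N0.
Qed.

Lemma partition_ge1 h : 1 <= partition h.
Proof.
rewrite -(null_cond1 h); apply: ler_sum => s _.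
rewrite ler_peMr ?null_cond_ge0// -expR0 ler_expR mulr_ge0 ?sqr_mag_ge0//.
by rewrite divr_ge0.
Qed.

Lemma bm_inv_partition : bounded_measurable (fun h => (partition h)^-1).
Proof.
have p0 h : 0 < partition h by exact: lt_le_trans (partition_ge1 h).
split; last first.
  exists 1 => h; rewrite ger0_norm; last by rewrite invr_ge0 ltW.
  by rewrite invf_le1// partition_ge1.
have -> : (fun h => (partition h)^-1) = fun h => expR (- ln (partition h)).
  by apply/funext => h; rewrite expRN lnK// posrE.
do 3![apply: measurableT_comp => //].
have [] // := @bm_sum R _ field _ (index_enum _) xpredT (fun t h => null_cond h t * tilt t).
by move=> t; apply: bm_mul; [exact: bm_null_cond | exact: bm_cst].
Qed.

Lemma bm_planted_cond s : bounded_measurable (fun h => planted_cond theta S h s).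
Proof.
under eq_fun do rewrite planted_condE.
apply: bm_mul bm_inv_partition; apply: bm_mul; first exact: bm_null_cond.
exact: bm_cst.
Qed.

Lemma planted_law_ge0 s : 0 <= planted_law mu theta S s.
Proof.
rewrite /planted_law -(field_mean_cst mu n 0).
apply: le_field_mean => [||h]; [exact: bm_cst | exact: bm_planted_cond |].
by rewrite divr_ge0 ?sumr_ge0// => *; exact: expR_ge0.
Qed.

Lemma planted_law_mean (f : config n -> R) :
  \sum_s planted_law mu theta S s * f s =
  field_mean mu (fun h => \sum_s planted_cond theta S h s * f s).
Proof.
rewrite field_mean_sum; last first.
  by move=> s; apply: bm_mul; [exact: bm_planted_cond | exact: bm_cst].
apply: eq_bigr => s _.
under [in RHS]eq_fun do rewrite mulrC.
by rewrite field_meanZ 1?mulrC//; exact: bm_planted_cond.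
Qed.

Lemma planted_law1 : \sum_s planted_law mu theta S s = 1.
Proof.
transitivity (\sum_s planted_law mu theta S s * 1).
  by apply: eq_bigr => s _; rewrite mulr1.
rewrite planted_law_mean -[RHS](field_mean_cst mu n 1); congr field_mean.
apply/funext => h; under eq_bigr do rewrite mulr1 planted_condE.
by rewrite -mulr_suml mulfV// gt_eqF// (lt_le_trans _ (partition_ge1 h)).
Qed.

(** The normalizing constant does not involve the field at a site outside [S],
    so averaging over that field turns the spin there into a fair coin
    independent of the other spins. *)
Lemma planted_law_twist1 i s : i \notin S ->
  planted_law mu theta S (twist [ffun j => j == i] s) = planted_law mu theta S s.
Proof.
move=> iS; set e : config n := [ffun j => j == i].
have tilt_twist t : tilt (twist e t) = tilt t.
  rewrite /tilt /sqr_mag spin_sum_twist// => j jS; rewrite ffunE.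
  by apply: contraNF iS => /eqP<-.
pose rest h t := \prod_(j | j != i) spin_prob (tanh (tnth h j)) (t j).
have null_rest h t :
    null_cond h t = spin_prob (tanh (tnth h i)) (t i) * rest h t.
  by rewrite null_condE (bigD1 i).
have rest_twist h t : rest h (twist e t) = rest h t.
  by apply: eq_bigr => j /negbTE ji; rewrite !ffunE ji addbF.
have twist_i t : twist e t i = ~~ t i by rewrite !ffunE eqxx addbT.
(* Pair each configuration with the one obtained by reversing spin [i]. *)
have partitionE h : partition h = 2^-1 * \sum_t rest h t * tilt t.
  have -> : partition h = 2^-1 * (partition h + partition h) by field.
  congr (_ * _); rewrite {1}/partition.
  rewrite (reindex_inj (inv_inj (twistK e)))/= -big_split/=.
  apply: eq_bigr => t _; rewrite tilt_twist -mulrDl !null_rest rest_twist twist_i.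
  rewrite -mulrDl; have := spin_prob1 (tanh (tnth h i)); rewrite big_bool/=.
  by case: (t i) => /=; rewrite 1?addrC => ->; rewrite mul1r.
pose G t h := rest h t * tilt t / partition h.
have lawE t : planted_law mu theta S t = 2^-1 * field_mean mu (G t).
  rewrite -(mean_spin_prob tanh_mean0 (t i)) -(@field_mean_indep _ _ _ i).
  - congr field_mean; apply/funext => h.
    by rewrite planted_condE null_rest /G !mulrA.
  - exact: bm_spin_prob.
  - apply: bm_mul bm_inv_partition; apply: bm_mul; last exact: bm_cst.
    apply: bm_prod => j.
    exact: (bm_comp (measurable_tnth j) (bm_spin_prob R (t j))).
  - move=> h h' hh'.
    have restE t' : rest h t' = rest h' t'.
      by apply: eq_bigr => j ji; rewrite hh'.
    by rewrite /G !partitionE restE; under eq_bigr do rewrite restE.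
rewrite !lawE; congr (_ * field_mean _ _); apply/funext => h.
by rewrite /G rest_twist tilt_twist.
Qed.

Lemma planted_law_twist eta s : {in S, forall i, eta i = false} ->
  planted_law mu theta S (twist eta s) = planted_law mu theta S s.
Proof.
move: (erefl #|[pred i | eta i]|); move: {2}#|_| => c.
elim: c eta => [|c IHc] eta ceta etaS.
  congr planted_law; apply/ffunP => i; rewrite ffunE.
  by have /card0_eq/(_ i) := ceta; rewrite inE => ->; rewrite addbF.
have /card_gt0P[i ieta] : (0 < #|[pred i | eta i]|)%N by rewrite ceta.
pose eta' : config n := [ffun j => (j != i) && eta j].
have -> : twist eta s = twist [ffun j => j == i] (twist eta' s).
  apply/ffunP => j; rewrite !ffunE.
  by case: eqVneq => [->|_]; rewrite /= ?addbF//; move: ieta; rewrite inE => ->.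
rewrite planted_law_twist1; last first.
  by apply/negP => /etaS; move: ieta; rewrite inE => ->.
apply: IHc => [|j jS]; last by rewrite ffunE etaS// andbF.
have := cardD1 i [pred i | eta i]; rewrite ieta ceta add1n => -[->].
by apply: eq_card => j; rewrite !inE ffunE.
Qed.

End planted_law.

(** * The gain of the planted law *)

Section planted_gain.
Context (R : realType) (mu : probability (measurableTypeR R) R) (n : nat).
Hypothesis tanh_mean0 : mean mu (@tanh R) = 0.
Variables (theta : R) (S : {set 'I_n}).
Hypotheses (theta0 : 0 <= theta) (S_gt1 : (1 < #|S|)%N).
Notation field := (n.-tuple (measurableTypeR R)).
Notation k := (#|S|%:R : R).
Implicit Types (s t e eta : config n) (h : field).

Let q := mean mu (fun x => tanh x ^+ 2).
Let U := sqr_mag R S.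

Let k2 : 2 <= k. Proof. by rewrite ler_nat. Qed.
Let k0 : k != 0. Proof. by rewrite gt_eqF// (lt_le_trans _ k2). Qed.

Lemma uniform_sqr_mag : uniform_mean U = 1.
Proof.
have [_ M2 _ _ _] := spin_sum_moments R S.
under eq_uniform_mean do rewrite /U /sqr_mag mulrC.
by rewrite uniform_meanZ M2 mulVf.
Qed.

Lemma uniform_sqr_mag2 : uniform_mean (fun s => U s ^+ 2) = 3 - 2 / k.
Proof.
have [_ _ _ M4 _] := spin_sum_moments R S.
under eq_uniform_mean do rewrite /U /sqr_mag mulrC exprMn -exprM.
by rewrite uniform_meanZ M4; field.
Qed.

Lemma uniform_sqr_mag3 : uniform_mean (fun s => U s ^+ 3) <= 15.
Proof.
have [_ _ _ _ M6] := spin_sum_moments R S.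
under eq_uniform_mean do rewrite /U /sqr_mag mulrC exprMn -exprM.
rewrite uniform_meanZ M6 exprVn mulrC ler_pdivrMr ?exprn_gt0 ?(lt_le_trans _ k2)//.
suff : 0 <= k * (30 * k - 16) by lra.
by rewrite mulr_ge0// subr_ge0; move: k2; lra.
Qed.

(** After averaging over the field, two configurations drawn independently
    given the field have spins with correlation [q] at each site; hence the
    factor [q ^+ 2] on a quadratic statistic. *)
Lemma correlated_sqr_mag s :
  \sum_(t : config n) (\prod_i spin_prob (q * spin R s i) (t i)) * U t =
  1 - q ^+ 2 + q ^+ 2 * U s.
Proof.
pose P (i : 'I_n) b := spin_prob (q * spin R s i) b.
pose f (i : 'I_n) (b : bool) : R := if b then 1 else -1.
transitivity (k^-1 * product_mean P (fun t => (\sum_(i in S) f i (t i)) ^+ 2)).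
  by rewrite -product_meanZ; apply: eq_bigr => t _; rewrite [U t]mulrC.
have P1 i : \sum_b P i b = 1 by exact: spin_prob1.
rewrite product_mean_sqr_sum//.
have m1 i : \sum_b P i b * f i b = q * spin R s i.
  by rewrite big_bool /P /f /spin_prob/=; field.
have m2 i : \sum_b P i b * f i b ^+ 2 = 1.
  by rewrite big_bool /P /f /spin_prob/=; field.
under eq_bigr do rewrite m1 m2 exprMn spin_sqr mulr1.
under [X in _ + X ^+ 2]eq_bigr do rewrite m1.
rewrite sumr_const -[(1 - q ^+ 2) *+ _]mulr_natl -mulr_sumr /U /sqr_mag -/(spin_sum R S s).
by field.
Qed.

(** The part of the variance of the squared magnetization that the field
    explains is the fraction [q ^+ 2] of the total [2 - 2 / k]; the rest is the
    mean variance at fixed field, from which the planted law gains. *)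
Lemma field_mean_sqr :
  field_mean mu (fun h : field => (\sum_s null_cond h s * U s) ^+ 2) =
  1 + q ^+ 2 * (2 - 2 / k).
Proof.
transitivity (field_mean mu (fun h : field =>
    \sum_s \sum_t U s * U t * (null_cond h s * null_cond h t))).
  congr field_mean; apply/funext => h; rewrite expr2 big_distrlr/=.
  by apply: eq_bigr => s _; apply: eq_bigr => t _; ring.
have bnn s t : bounded_measurable (fun h : field => null_cond h s * null_cond h t).
  by apply: bm_mul; exact: bm_null_cond.
rewrite field_mean_sum => [|s]; last first.
  by apply: bm_sum => t; apply: bm_mul => //; exact: bm_cst.
transitivity (uniform_mean (fun s => (1 - q ^+ 2) * U s + q ^+ 2 * U s ^+ 2)).
  rewrite uniform_meanE; apply: eq_bigr => s _.
  rewrite field_mean_sum => [|t]; last by apply: bm_mul => //; exact: bm_cst.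
  under eq_bigr do rewrite field_meanZ// field_mean_null_cond2// mulrACA [U s * _]mulrC.
  have -> : (1 - q ^+ 2) * U s + q ^+ 2 * U s ^+ 2 =
      U s * (1 - q ^+ 2 + q ^+ 2 * U s) by ring.
  rewrite -(correlated_sqr_mag s) !mulr_sumr; apply: eq_bigr => t _.
  by rewrite -/q; ring.
by rewrite uniform_meanD !uniform_meanZ uniform_sqr_mag uniform_sqr_mag2; ring.
Qed.

Lemma field_mean_uniform (f : config n -> R) :
  field_mean mu (fun h : field => \sum_s null_cond h s * f s) = uniform_mean f.
Proof.
rewrite field_mean_sum => [|s]; last first.
  by apply: bm_mul; [exact: bm_null_cond | exact: bm_cst].
rewrite uniform_meanE; apply: eq_bigr => s _.
under eq_fun do rewrite mulrC.
by rewrite field_meanZ ?field_mean_null_cond// 1?mulrC//; exact: bm_null_cond.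
Qed.

(** [truncated_tilt_ge] at each field, averaged over the field. *)
Lemma planted_truncated_mean_ge (t M : R) :
  0 <= t -> t <= theta / 2 -> 0 < M ->
  1 + t * ((2 - 2 / k) * (1 - q ^+ 2)) - 15 * t ^+ 2 - (3 + 15 * t) / M <=
  \sum_s planted_law mu theta S s * Num.min (U s) M.
Proof.
move=> t0 t_theta M0.
pose F s := U s - U s ^+ 2 / M + t * (U s ^+ 2 - U s ^+ 3 / M) - t ^+ 2 * U s ^+ 3.
have bF : bounded_measurable (fun h : field => \sum_s null_cond h s * F s).
  by apply: bm_sum => s; apply: bm_mul; [exact: bm_null_cond | exact: bm_cst].
have bU2 : bounded_measurable
    (fun h : field => - t * (\sum_s null_cond h s * U s) ^+ 2).
  under eq_fun do rewrite expr2; apply: bm_mul; first exact: bm_cst.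
  by apply: bm_mul; apply: bm_sum => s; apply: bm_mul;
    [exact: bm_null_cond | exact: bm_cst | exact: bm_null_cond | exact: bm_cst].
rewrite planted_law_mean//.
apply: (@le_trans _ _ (field_mean mu (fun h : field =>
  \sum_s null_cond h s * F s + - t * (\sum_s null_cond h s * U s) ^+ 2))).
  rewrite field_meanD// field_meanZ; last first.
    under eq_fun do rewrite expr2.
    by apply: bm_mul; apply: bm_sum => s; apply: bm_mul;
      [exact: bm_null_cond | exact: bm_cst | exact: bm_null_cond | exact: bm_cst].
  rewrite field_mean_sqr field_mean_uniform.
  have -> : uniform_mean F = 1 + (t - M^-1) * (3 - 2 / k) +
      (- (t / M + t ^+ 2)) * uniform_mean (fun s => U s ^+ 3).
    rewrite -[X in X + _ + _]uniform_sqr_mag -uniform_sqr_mag2 -!uniform_meanZ.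
    rewrite -!uniform_meanD; apply: eq_uniform_mean => s.
    by rewrite /F; ring.
  have : (t / M + t ^+ 2) * uniform_mean (fun s => U s ^+ 3) <= (t / M + t ^+ 2) * 15.
    rewrite ler_wpM2l ?uniform_sqr_mag3//.
    by rewrite addr_ge0 ?sqr_ge0// divr_ge0// ltW.
  have : M^-1 * (3 - 2 / k) <= M^-1 * 3.
    rewrite ler_wpM2l ?invr_ge0 ?(ltW M0)//.
    by rewrite lerBlDr lerDl divr_ge0// ler0n.
  rewrite /q; set Q := mean _ _; set V := uniform_mean _.
  by set kk := k^-1; set MM := M^-1; lra.
apply: le_field_mean; first exact: bm_add.
  apply: bm_sum => s; apply: bm_mul; [exact: bm_planted_cond | exact: bm_cst].
move=> h.
have := @truncated_tilt_ge R _ (null_cond h) (null_cond_ge0 h) (null_cond1 h)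
  U theta t M (sqr_mag_ge0 _ _) t0 t_theta M0.
set W := \sum_s _ * expR _ => tilt_ge.
have -> : \sum_s planted_cond theta S h s * Num.min (U s) M =
    (\sum_s null_cond h s * (Num.min (U s) M * expR (theta / 2 * U s))) / W.
  rewrite mulr_suml; apply: eq_bigr => s _.
  by rewrite planted_condE -/(sqr_mag R S) -/U -/W; ring.
apply: le_trans tilt_ge; rewrite le_eqVlt; apply/orP; left; apply/eqP.
have e1 : \sum_s null_cond h s * U s ^+ 1 = \sum_s null_cond h s * U s.
  by apply: eq_bigr => s _; rewrite expr1.
rewrite e1.
have -> : \sum_s null_cond h s * F s =
   \sum_s null_cond h s * U s - (\sum_s null_cond h s * U s ^+ 2) / M +
   t * (\sum_s null_cond h s * U s ^+ 2 - (\sum_s null_cond h s * U s ^+ 3) / M) -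
   t ^+ 2 * \sum_s null_cond h s * U s ^+ 3.
  rewrite !mulr_suml -!sumrB !mulr_sumr -big_split -sumrB/=.
  by apply: eq_bigr => s _; rewrite /F; ring.
by ring.
Qed.

End planted_gain.

Section gain.
Context (R : realType) (mu : probability (measurableTypeR R) R).
Hypothesis tanh_mean0 : mean mu (@tanh R) = 0.

Lemma bm_tanh_sqr :
  @bounded_measurable R _ (measurableTypeR R) (fun x => tanh x ^+ 2).
Proof. by under eq_fun do rewrite expr2; apply: bm_mul; exact: bm_tanh. Qed.

Lemma mean_sech_sqr :
  mean mu (fun x => sech x ^+ 2) = 1 - mean mu (fun x => tanh x ^+ 2).
Proof.
rewrite -mulN1r -mean_affine; last exact: bm_tanh_sqr.
by apply: eq_mean => x; rewrite sech_sqr mulN1r.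
Qed.

Lemma mean_tanh_sqr_ge0 : 0 <= mean mu (fun x => tanh x ^+ 2).
Proof. by rewrite meanE Rintegral_ge0// => x _; exact: sqr_ge0. Qed.

(** The gain is linear in [t] and the losses are quadratic in [t] or vanish as
    [M] grows, so a small [t] and then a large [M] leave a positive constant
    that does not depend on [n] and [S]. *)
Lemma planted_gain (theta : R) : 0 < theta ->
  0 < mean mu (fun x => sech x ^+ 2) ->
  exists kappa M : R, [/\ 0 < kappa, 0 < M &
    forall n (S : {set 'I_n}), (1 < #|S|)%N ->
      1 + kappa <= \sum_s planted_law mu theta S s * Num.min (sqr_mag R S s) M].
Proof.
move=> theta0; rewrite mean_sech_sqr subr_gt0 => q1.
set q := mean mu _ in q1; have q0 : 0 <= q by exact: mean_tanh_sqr_ge0.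
pose d := 1 - q ^+ 2; have d0 : 0 < d by rewrite subr_gt0 expr_lt1.
pose t := Num.min (theta / 2) (d / 30).
have t0 : 0 < t by rewrite lt_min !divr_gt0.
have t_theta : t <= theta / 2 by rewrite ge_min lexx.
have td : t <= d / 30 by rewrite ge_min lexx orbT.
have td0 : 0 < t * d by rewrite mulr_gt0.
(* The linear gain is at least [t * d]; the quadratic loss takes at most half of
   it, and [M] is chosen for the truncation to take a quarter. *)
pose kappa := t * d / 4; pose M := (3 + 15 * t) / kappa.
have kappa0 : 0 < kappa by rewrite divr_gt0.
have M0 : 0 < M by rewrite divr_gt0// addr_gt0// mulr_gt0.
exists kappa, M; split=> // n S S1.
have := @planted_truncated_mean_ge R mu n tanh_mean0 theta S (ltW theta0) S1
  t M (ltW t0) t_theta M0.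
apply: le_trans; rewrite -/q -/d.
have -> : (3 + 15 * t) / M = kappa.
  by rewrite /M; field; rewrite !gt_eqF// addr_gt0// mulr_gt0.
have k2 : 1 <= 2 - 2 / #|S|%:R :> R.
  have : 2 <= #|S|%:R :> R by rewrite ler_nat.
  move=> h; have : 2 / #|S|%:R <= 1 :> R.
    by rewrite ler_pdivrMr ?mul1r// (lt_le_trans _ h).
  by lra.
have h1 : t * d <= t * ((2 - 2 / #|S|%:R) * d).
  by rewrite ler_wpM2l ?(ltW t0)// ler_peMl// ltW.
have h2 : t * t <= t * (d / 30) by rewrite ler_wpM2l// ltW.
move: h1 h2; rewrite /kappa expr2; set X := t * (_ * d); set Y := t * t.
by rewrite mulrA; lra.
Qed.

End gain.

(** * Tests under the null law *)

Section tests.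
Context (R : realType).

Lemma iid_probE n m (P : config n -> R) (A : pred (sample n m)) :
  iid_prob P A = product_mean (fun=> P) (fun x : sample n m => (A x)%:R).
Proof.
rewrite /iid_prob /product_mean big_mkcond; apply: eq_bigr => x _.
by case: (A x); rewrite ?mulr1 ?mulr0.
Qed.

Lemma iid_prob_ge0 n m (P : config n -> R) (A : pred (sample n m)) :
  (forall s, 0 <= P s) -> 0 <= iid_prob P A.
Proof. by move=> P0; apply: sumr_ge0 => x _; exact: prodr_ge0. Qed.

Lemma le_iid_prob n m (P : config n -> R) (A B : pred (sample n m)) :
  (forall s, 0 <= P s) -> (forall x, A x -> B x) -> iid_prob P A <= iid_prob P B.
Proof.
move=> P0 AB; rewrite !iid_probE; apply: le_product_mean => // x.
by rewrite ler_nat; case: (A x) (AB x) => // ->.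
Qed.

Lemma phi_setE k n m (S : {set 'I_n}) (x : sample n m) : #|S| = k ->
  phi_set R k S x = m%:R^-1 * \sum_j sqr_mag R S (x j).
Proof.
move=> cS; rewrite /phi_set /empirical_second_moment.
rewrite -scalemxAr -scalemxAl mxE mulrCA; congr (_ * _).
rewrite mulmx_sumr mulmx_suml summxE mulr_sumr; apply: eq_bigr => j _.
rewrite mulmxA -(mulmxA (_ *m _)) mxE big_ord1 /sqr_mag cS mulrC expr2; congr (_ * _ * _).
- rewrite !mxE /spin_sum [RHS]big_mkcond; apply: eq_bigr => i _.
  by rewrite !mxE; case: (i \in S); rewrite ?mul1r ?mul0r.
- rewrite !mxE /spin_sum [RHS]big_mkcond; apply: eq_bigr => i _.
  by rewrite !mxE; case: (i \in S); rewrite ?mulr1 ?mulr0.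
Qed.

Lemma uniform_weight_sum n : \sum_(s : config n) 2^-1 ^+ n = 1 :> R.
Proof.
by rewrite -[RHS](uniform_mean_cst n 1) uniform_meanE; apply: eq_bigr => s _; rewrite mulr1.
Qed.

(** Chernoff's bound: the Laplace transform of a squared magnetization is at
    most that of a chi-square variable, whose mean is 1, so every threshold
    above 1 is exceeded at an exponentially small rate uniform in [n] and
    [S]. *)
Lemma null_phi_set_tail (tau : R) : 1 < tau ->
  exists2 c : R, 0 < c & forall k n m (S : {set 'I_n}), (0 < k)%N -> (0 < m)%N ->
    #|S| = k ->
    iid_prob (fun=> 2^-1 ^+ n) (fun x : sample n m => tau <= phi_set R k S x) <=
    expR (- (c * m%:R)).
Proof.
move=> tau1; have tau0 : 0 < tau by exact: lt_trans tau1.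
(* Twice the exponent in Chernoff's bound, half way to the point where
   [(1 + y * tau) * (1 - y)] comes back to 1. *)
pose y := (tau - 1) / (2 * tau).
have y0 : 0 < y by rewrite divr_gt0 ?subr_gt0// mulr_gt0.
have y_tau : y * tau = (tau - 1) / 2 by rewrite /y; field; rewrite gt_eqF.
have y1 : y < 1 by rewrite /y ltr_pdivrMr ?mulr_gt0// mul1r; lra.
have gap : 1 < expR (y * tau) * (1 - y).
  apply: (@lt_le_trans _ _ ((1 + y * tau) * (1 - y))).
    rewrite mulrBr mulr1 mulrDl mul1r y_tau.
    have : (tau - 1) / 2 * y < (tau - 1) / 2 * 1.
      by rewrite ltr_pM2l// divr_gt0// subr_gt0.
    have : y * 2 < tau - 1.
      by rewrite /y -mulrA gtr_pMr ?subr_gt0// invfM mulrAC mulVf// mul1r invf_lt1.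
    lra.
  by rewrite ler_wpM2r ?expR_ge1Dx// subr_ge0 ltW.
pose r := expR (y * tau) * (1 - y).
have c0 : 0 < ln r / 2 by rewrite divr_gt0// ln_gt0.
exists (ln r / 2) => // k n m S k0 m0 cS.
pose l := y / 2; pose U := sqr_mag R S.
have kR : 0 < k%:R :> R by rewrite ltr0n.
have mgf : uniform_mean (fun s => expR (l * U s)) ^+ 2 * (1 - y) <= 1.
  have lk : 2 * (l / k%:R) * #|S|%:R = y.
    by rewrite cS /l; field; rewrite gt_eqF.
  have := @spin_sum_sqr_mgf R n S (l / k%:R); rewrite lk.
  rewrite (@eq_uniform_mean _ _ _ (fun s => expR (l * U s))); last first.
    by move=> s; rewrite /U /sqr_mag cS; congr expR; ring.
  by apply => //; rewrite divr_ge0// /l divr_ge0// ltW.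
set E := uniform_mean _ in mgf.
have E0 : 0 <= E by apply: uniform_mean_ge0 => s; exact: expR_ge0.
have tiltE : expR (- (l * tau)) * E <= expR (- (ln r / 2)).
  rewrite -(@ler_pXn2r _ 2) ?nnegrE ?mulr_ge0 ?expR_ge0//.
  rewrite exprMn -!expRM_natl !mulrN mulrC.
  rewrite (_ : 2 * (l * tau) = y * tau); last by rewrite /l; field.
  rewrite (_ : 2 * (ln r / 2) = ln r); last by field.
  rewrite !expRN lnK ?posrE ?(lt_trans _ gap)// /r invfM.
  rewrite -[leRHS]mulrC ler_wpM2r ?invr_ge0 ?expR_ge0//.
  by rewrite -[leRHS]mul1r ler_pdivlMr ?subr_gt0.
rewrite iid_probE.
apply: (@le_trans _ _ (product_mean (fun=> (fun=> 2^-1 ^+ n))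
    (fun x : sample n m => \prod_(j < m) expR (l * U (x j) - l * tau)))).
  apply: le_product_mean => [_ s|x]; first by rewrite exprn_ge0// invr_ge0.
  rewrite -expR_sum phi_setE//.
  have [tau_phi|_] := leP tau; last exact: expR_ge0.
  rewrite -[leLHS]expR0 ler_expR sumrB -mulr_sumr sumr_const card_ord -mulr_natl.
  rewrite subr_ge0 mulrCA; apply: ler_wpM2l; first by rewrite divr_ge0// ltW.
  by move: tau_phi; rewrite ler_pdivlMl ?ltr0n.
rewrite (product_mean_prod _ (fun _ s => expR (l * U s - l * tau))).
rewrite (eq_bigr (fun=> expR (- (l * tau)) * E)); last first.
  move=> j _; rewrite /E -uniform_meanZ uniform_meanE; apply: eq_bigr => s _.
  by rewrite expRD mulrC [in RHS]mulrC mulrA mulrAC [in RHS]mulrC; ring.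
rewrite prodr_const card_ord.
rewrite (_ : - (ln r / 2 * m%:R) = m%:R * - (ln r / 2)); last by ring.
rewrite expRM_natl.
by rewrite lerXn2r// ?nnegrE ?expR_ge0// mulr_ge0// expR_ge0.
Qed.

Lemma card_subsets_le n k : (#|[pred S : {set 'I_n} | #|S| == k]| <= n ^ k)%N.
Proof.
rewrite -[#|_|]cardsE card_draws card_ord.
apply: (@leq_trans (n ^_ k)).
  by rewrite -bin_ffact leq_pmulr// fact_gt0.
elim: k => [|k IHk]; first by rewrite ffactn0.
by rewrite ffactnSr expnSr leq_mul// leq_subr.
Qed.

(** Union bound over the candidate sets. *)
Lemma null_phi1_tail (tau : R) : 1 < tau ->
  exists2 c : R, 0 < c & forall k n m, (0 < k)%N -> (0 < m)%N ->
    iid_prob (fun=> 2^-1 ^+ n) (fun x : sample n m => tau <= phi1 R k x) <=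
    n%:R ^+ k * expR (- (c * m%:R)).
Proof.
move=> tau1; have [c c0 tail] := null_phi_set_tail tau1.
have tau0 : 0 < tau by exact: lt_trans tau1.
exists c => // k n m k0 m0.
have w0 (s : config n) : 0 <= 2^-1 ^+ n :> R by rewrite exprn_ge0// invr_ge0.
apply: (@le_trans _ _ (\sum_(S : {set 'I_n} | #|S| == k)
    iid_prob (fun=> 2^-1 ^+ n) (fun x : sample n m => tau <= phi_set R k S x))).
  rewrite iid_probE; under [leRHS]eq_bigr do rewrite iid_probE.
  rewrite -product_mean_sum; apply: le_product_mean => // x.
  have [tau_phi|_] := leP tau; last by apply: sumr_ge0.
  have [S /andP[cS tauS]] : exists S : {set 'I_n},
      (#|S| == k) && (tau <= phi_set R k S x).
    apply/existsP; apply: contraT; rewrite negb_exists => /forallP nS.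
    suff : phi1 R k x < tau by rewrite ltNge tau_phi.
    rewrite /phi1; apply: (big_ind (fun z => z < tau)) => // [u v|S cS].
      by rewrite gt_max => -> ->.
    by have := nS S; rewrite cS/= ltNge.
  by rewrite (bigD1 S)//= tauS lerDl sumr_ge0.
apply: (@le_trans _ _ (\sum_(S : {set 'I_n} | #|S| == k) expR (- (c * m%:R)))).
  by apply: ler_sum => S /eqP cS; exact: tail.
rewrite sumr_const -[_ *+ #|_|]mulr_natl ler_wpM2r ?expR_ge0//.
by rewrite -natrX ler_nat card_subsets_le.
Qed.

Lemma null_phi2_tail (tau : R) k n m : 0 < tau -> (0 < k)%N -> (0 < m)%N ->
  iid_prob (fun=> 2^-1 ^+ n) (fun x : sample n m => tau < phi2 R k x) <=
  2 / tau ^+ 2 * (n%:R ^+ 2 / (m%:R * k%:R ^+ 2)).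
Proof.
move=> tau0 k0 m0; have kR : 0 < k%:R :> R by rewrite ltr0n.
have mR : 0 < m%:R :> R by rewrite ltr0n.
pose T := spin_sum R [set: 'I_n]%SET.
have TE (s : config n) : \sum_i spin R s i = T s.
  by apply: eq_bigl => i; rewrite finset.in_setT.
pose f (_ : 'I_m) (s : config n) := T s ^+ 2 - n%:R.
have cardT : #|[set: 'I_n]%SET| = n by rewrite cardsT card_ord.
have [_ M2 _ M4 _] := spin_sum_moments R [set: 'I_n]%SET.
rewrite !cardT in M2 M4.
have f0 j : \sum_s 2^-1 ^+ n * f j s = 0.
  by rewrite mean_centred ?uniform_weight_sum// -uniform_meanE M2 subrr.
have f2 j : \sum_s 2^-1 ^+ n * f j s ^+ 2 = 2 * n%:R ^+ 2 - 2 * n%:R.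
  rewrite -uniform_meanE.
  transitivity (uniform_mean
      (fun s => T s ^+ 4 + (- 2 * n%:R * T s ^+ 2 + n%:R ^+ 2))).
    by apply: eq_uniform_mean => s; rewrite /f; ring.
  by rewrite !uniform_meanD uniform_meanZ uniform_mean_cst M2 M4; ring.
have c0 : 0 < tau * (m%:R * k%:R) by rewrite !mulr_gt0.
have := @product_mean_chebyshev R 'I_m (config n) (fun _ _ => 2^-1 ^+ n)
  (fun=> uniform_weight_sum n) f _ _ f0 c0.
rewrite iid_probE => cheb; apply: (le_trans _ (le_trans (cheb _) _)).
- apply: le_product_mean => [_ s|x]; first by rewrite exprn_ge0// invr_ge0.
  rewrite /phi2; under eq_bigr do rewrite TE.
  have [tau_phi|_] := ltP tau; last by rewrite ler0n.
  suff -> : (tau * (m%:R * k%:R) <= `|\sum_i f i (x i)|)%R by [].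
  apply: le_trans (ler_norm _); rewrite -ler_pdivlMr ?mulr_gt0// mulrC.
  exact: ltW.
- by move=> _ s; rewrite exprn_ge0// invr_ge0.
- under eq_bigr do rewrite f2.
  rewrite sumr_const card_ord -[_ *+ m]mulr_natl.
  have -> : 2 / tau ^+ 2 * (n%:R ^+ 2 / (m%:R * k%:R ^+ 2)) =
      (m%:R * (2 * n%:R ^+ 2)) / (tau * (m%:R * k%:R)) ^+ 2.
    by field; rewrite !gt_eqF.
  rewrite ler_wpM2r ?invr_ge0 ?sqr_ge0// ler_wpM2l ?(ltW mR)//.
  by rewrite gerBl mulr_ge0.
Qed.

End tests.

(** * Tests under the planted law *)

Section planted_tests.
Context (R : realType) (n m k : nat) (S : {set 'I_n}) (P : config n -> R).
Hypotheses (k0 : (0 < k)%N) (m0 : (0 < m)%N) (cS : #|S| = k).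
Hypotheses (P0 : forall s, 0 <= P s) (P1 : \sum_s P s = 1).
Variables (M e d : R).
Hypotheses (d0 : 0 < d) (M0 : 0 < M).
Hypothesis gain : e + d <= \sum_s P s * Num.min (sqr_mag R S s) M.

Let mR : 0 < m%:R :> R. Proof. by rewrite ltr0n. Qed.
Let kR : 0 < k%:R :> R. Proof. by rewrite ltr0n. Qed.

Lemma mean_sqr_mag_tail :
  iid_prob P (fun x : sample n m => m%:R^-1 * \sum_j sqr_mag R S (x j) <= e) <=
  M ^+ 2 / (m%:R * d ^+ 2).
Proof.
rewrite iid_probE; pose g s := Num.min (sqr_mag R S s) M.
have gM s : 0 <= g s <= M.
  by rewrite /g le_min sqr_mag_ge0 ltW//= ge_min lexx orbT.
apply: le_trans (iid_lower_tail P1 m0 P0 gM d0 gain).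
apply: le_product_mean => // x; rewrite ler_nat.
have [le_e|//] := leP (_ * _) e.
rewrite (le_trans _ le_e)// ler_wpM2l ?invr_ge0//.
by apply: ler_sum => j _; rewrite /g ge_min lexx.
Qed.

Lemma planted_phi1_tail :
  iid_prob P (predC (fun x : sample n m => e <= phi1 R k x)) <=
  M ^+ 2 / (m%:R * d ^+ 2).
Proof.
apply: le_trans mean_sqr_mag_tail; apply: le_iid_prob => // x /=.
rewrite -ltNge => /ltW; apply: le_trans.
rewrite -(phi_setE R x cS) /phi1 (bigD1 S)/= ?cS//.
by rewrite le_max lexx.
Qed.

Definition off_planted (eta : config n) : config n :=
  [ffun i => (i \notin S) && eta i].

Definition scramble (eta x : sample n m) : sample n m :=
  [ffun j => twist (off_planted (eta j)) (x j)].

(** Flips outside [S] preserve [P], so they may be averaged over uniformly.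
    Given [x], the spins outside [S] then become fresh fair coins, while those
    on [S] are kept: fluctuations outside [S] can be estimated conditionally on
    the magnetization of [S], however large it is. *)
Lemma product_mean_scramble (F : sample n m -> R) :
  (forall eta s : config n, {in S, forall i, eta i = false} ->
    P (twist eta s) = P s) ->
  product_mean (fun=> P) F =
  product_mean (fun=> P) (fun x =>
    product_mean (fun _ _ => 2^-1 ^+ n) (fun eta => F (scramble eta x))).
Proof.
move=> P_twist.
have inv eta : product_mean (fun=> P) (fun x => F (scramble eta x)) =
    product_mean (fun=> P) F.
  have scrambleK : involutive (scramble eta).
    by move=> x; apply/ffunP => j; rewrite !ffunE twistK.
  rewrite [RHS](reindex_inj (inv_inj scrambleK))/=; apply: eq_bigr => x _.
  congr (_ * _); apply: eq_bigr => j _; rewrite ffunE P_twist// => i iS.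
  by rewrite ffunE iS.
transitivity (product_mean (fun _ _ => 2^-1 ^+ n)
    (fun eta => product_mean (fun=> P) (fun x => F (scramble eta x)))).
  under [RHS]eq_product_mean do rewrite inv.
  by rewrite product_mean_cst// => j; exact: uniform_weight_sum.
rewrite /product_mean.
under [LHS]eq_bigr do rewrite mulr_sumr.
under [RHS]eq_bigr do rewrite mulr_sumr.
rewrite exchange_big/=; apply: eq_bigr => x _.
by apply: eq_bigr => eta _; rewrite mulrCA.
Qed.

Section fresh_coins.
Variable x : sample n m.
Let A j := spin_sum R S (x j).
Let B j (eta : config n) := spin_sum R (~: S)%SET (twist (x j) eta).
Let r : R := #|(~: S)%SET|%:R.
Let f j eta := 2 * A j * B j eta + (B j eta ^+ 2 - r).

Lemma phi2_scramble eta :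
  phi2 R k (scramble eta x) =
  m%:R^-1 * (\sum_j sqr_mag R S (x j)) - 1 +
  (m%:R * k%:R)^-1 * \sum_j f j (eta j).
Proof.
have sumE j : \sum_i spin R (scramble eta x j) i = A j + B j (eta j).
  have -> : scramble eta x j = twist (off_planted (eta j)) (x j) by rewrite ffunE.
  rewrite (bigID [in S])/=; congr (_ + _).
    by apply: eq_bigr => i iS; rewrite spin_twist [off_planted _ _]ffunE iS.
  rewrite /B /spin_sum; apply: eq_big => i; first by rewrite finset.in_setC.
  by move=> iS; rewrite [twist (x j) _]twistC !spin_twist [off_planted _ _]ffunE iS.
have nE : n%:R = k%:R + r.
  by rewrite /r -cS -natrD cardsC card_ord.
rewrite /phi2; under eq_bigr do rewrite sumE nE.
rewrite (eq_bigr (fun j => (k%:R * sqr_mag R S (x j) - k%:R) + f j (eta j))); last first.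
  move=> j _; rewrite /sqr_mag cS -/(A j) /f; field; by rewrite gt_eqF.
rewrite big_split/= sumrB -mulr_sumr sumr_const card_ord -[_ *+ m]mulr_natl.
by field; rewrite !gt_eqF.
Qed.

Lemma fresh_coins_law (g : R -> R) j :
  uniform_mean (fun eta => g (B j eta)) =
  uniform_mean (fun s => g (spin_sum R (~: S)%SET s)).
Proof. exact: (uniform_mean_twist (x j) (fun s => g (spin_sum R (~: S)%SET s))). Qed.

Lemma fresh_coins_mean j : \sum_eta 2^-1 ^+ n * f j eta = 0.
Proof.
rewrite -uniform_meanE; have [M1 M2 _ _ _] := spin_sum_moments R (~: S)%SET.
rewrite (fresh_coins_law (fun z => 2 * A j * z + (z ^+ 2 - r))).
by rewrite !uniform_meanD uniform_meanZ uniform_mean_cst M1 M2 mulr0 add0r subrr.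
Qed.

(** The cross term contributes [4 * A ^+ 2 * r] and the square of the sum of
    the coins at most [2 * r ^+ 2]; the odd moments cancel. *)
Lemma fresh_coins_variance j :
  \sum_eta 2^-1 ^+ n * f j eta ^+ 2 <= 4 * A j ^+ 2 * r + 2 * r ^+ 2.
Proof.
have [M1 M2 M3 M4 _] := spin_sum_moments R (~: S)%SET.
set T := spin_sum R _ in M1 M2 M3 M4.
pose F z := z ^+ 4 + (4 * A j * z ^+ 3 + ((4 * A j ^+ 2 - 2 * r) * z ^+ 2 +
  (- (4 * A j * r) * z + r ^+ 2))).
rewrite -uniform_meanE.
rewrite (@eq_uniform_mean _ _ _ (fun eta => F (B j eta))); last first.
  by move=> eta; rewrite /f /F; ring.
rewrite fresh_coins_law -/T /F.
rewrite !uniform_meanD !uniform_meanZ uniform_mean_cst M1 M2 M3 M4.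
by rewrite -/r; have : 0 <= r; [exact: ler0n | lra].
Qed.

(** The excess [z] of the conditional mean over the threshold and the
    conditional variance both grow linearly with the squared magnetization of
    [S]; as Chebyshev's bound divides by [z ^+ 2], the worst case is the smallest
    excess [d]. *)
Lemma fresh_coins_tail (tau : R) :
  tau + d <= m%:R^-1 * (\sum_j sqr_mag R S (x j)) - 1 -> 0 < tau ->
  product_mean (fun _ _ => 2^-1 ^+ n)
    (fun eta => (phi2 R k (scramble eta x) <= tau)%R%:R) <=
  (4 / d + (4 * tau + 6) / d ^+ 2) * (n%:R ^+ 2 / (m%:R * k%:R ^+ 2)).
Proof.
set Q := _ - 1 => tauQ tau0.
pose z := Q - tau; have dz : d <= z by rewrite /z lerBrDl.
have z0 : 0 < z by exact: lt_le_trans dz.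
have c0 : 0 < z * (m%:R * k%:R) by rewrite !mulr_gt0.
have := @product_mean_chebyshev R 'I_m (config n) (fun _ _ => 2^-1 ^+ n)
  (fun=> uniform_weight_sum R n) f _ _ fresh_coins_mean c0.
move=> cheb; apply: (le_trans _ (le_trans (cheb _) _)).
- apply: le_product_mean => [_ s|eta]; first by rewrite exprn_ge0// invr_ge0.
  rewrite phi2_scramble -/Q.
  have [le_tau|_] := leP (_ + _) tau; last by rewrite ler0n.
  suff -> : (z * (m%:R * k%:R) <= `|\sum_i f i (eta i)|)%R by [].
  rewrite -normrN; apply: le_trans (ler_norm _).
  rewrite -ler_pdivlMr ?mulr_gt0// mulNr mulrC.
  by clear cheb; move: le_tau; rewrite /z; set y := _ * _; lra.
- by move=> _ s; rewrite exprn_ge0// invr_ge0.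
- clear cheb; have r0 : 0 <= r by exact: ler0n.
  have rn : r <= n%:R by rewrite ler_nat (leq_trans (max_card _))// card_ord.
  have kn : k%:R <= n%:R :> R.
    by rewrite ler_nat -cS (leq_trans (max_card _))// card_ord.
  have AE : \sum_j A j ^+ 2 = m%:R * k%:R * (Q + 1).
    rewrite /Q subrK [m%:R * _]mulrC -mulrA mulVKf ?gt_eqF// mulr_sumr.
    by apply: eq_bigr => j _; rewrite /sqr_mag cS mulrC divfK// gt_eqF.
  apply: (@le_trans _ _
    ((m%:R * (4 * Q + 6) * n%:R ^+ 2) / (z * (m%:R * k%:R)) ^+ 2)).
    rewrite ler_wpM2r ?invr_ge0 ?sqr_ge0//.
    apply: (@le_trans _ _ (\sum_j (4 * A j ^+ 2 * r + 2 * r ^+ 2))).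
      by apply: ler_sum => j _; exact: fresh_coins_variance.
    rewrite big_split/= sumr_const card_ord -[_ *+ m]mulr_natl.
    rewrite -mulr_suml -mulr_sumr AE.
    have rk : k%:R * r <= n%:R ^+ 2 by rewrite expr2 ler_pM// ltW.
    have rr : r ^+ 2 <= n%:R ^+ 2 by rewrite !expr2 ler_pM.
    have Q1 : 0 <= m%:R * (4 * (Q + 1)).
      by rewrite !mulr_ge0 ?(ltW mR)//; move: tauQ tau0 d0; lra.
    have := ler_wpM2l Q1 rk; have := ler_wpM2l (ltW mR) rr; lra.
  have -> : m%:R * (4 * Q + 6) * n%:R ^+ 2 / (z * (m%:R * k%:R)) ^+ 2 =
      ((4 * Q + 6) / z ^+ 2) * (n%:R ^+ 2 / (m%:R * k%:R ^+ 2)).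
    by field; rewrite !gt_eqF.
  apply: ler_wpM2r.
    by rewrite divr_ge0 ?sqr_ge0// mulr_ge0 ?sqr_ge0// ltW.
  have -> : (4 * Q + 6) / z ^+ 2 = 4 / z + (4 * tau + 6) / z ^+ 2.
    by rewrite /z; field; rewrite gt_eqF.
  have zV : z^-1 <= d^-1 by rewrite lef_pV2.
  apply: lerD; first by rewrite ler_wpM2l.
  apply: ler_wpM2l; first by rewrite addr_ge0// mulr_ge0// ltW.
  by rewrite -!exprVn lerXn2r ?nnegrE ?invr_ge0// ltW.
Qed.

End fresh_coins.

(** Either the magnetization of [S] is abnormally small, or the coins outside
    [S] make up for its excess. *)
Lemma planted_phi2_tail (tau : R) :
  (forall eta s : config n, {in S, forall i, eta i = false} ->
    P (twist eta s) = P s) ->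
  0 < tau -> tau + d + 1 <= e ->
  iid_prob P (predC (fun x : sample n m => tau < phi2 R k x)) <=
  M ^+ 2 / (m%:R * d ^+ 2) +
  (4 / d + (4 * tau + 6) / d ^+ 2) * (n%:R ^+ 2 / (m%:R * k%:R ^+ 2)).
Proof.
move=> P_twist tau0 tau_e; set K := _ * (_ / _).
have K0 : 0 <= K.
  apply: mulr_ge0; last first.
    by rewrite divr_ge0 ?sqr_ge0// mulr_ge0 ?sqr_ge0// ltW.
  have t6 : 0 <= 4 * tau + 6 by rewrite addr_ge0// mulr_ge0// ltW.
  by rewrite addr_ge0// divr_ge0 ?sqr_ge0// ltW.
apply: (@le_trans _ _ (product_mean (fun=> P) (fun x : sample n m =>
   (m%:R^-1 * \sum_j sqr_mag R S (x j) <= e)%R%:R + K))); last first.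
  rewrite product_meanD product_mean_cst// lerD2r -iid_probE.
  exact: mean_sqr_mag_tail.
rewrite iid_probE product_mean_scramble//.
refine (le_product_mean _ _) => [_ s|x]; first exact: P0.
under eq_product_mean do rewrite /= -leNgt.
have [_|e_lt] := leP (_ * _) e.
  apply: (@le_trans _ _ 1); last by rewrite lerDl.
  rewrite -[leRHS](product_mean_cst
    (P := fun (_ : 'I_m) (_ : config n) => 2^-1 ^+ n)
    (fun=> uniform_weight_sum R n) 1).
  apply: le_product_mean => [_ s|eta]; first by rewrite exprn_ge0// invr_ge0.
  by rewrite lern1 leq_b1.
rewrite add0r; apply: fresh_coins_tail => //.
by rewrite lerBrDr (le_trans tau_e)// ltW.
Qed.

End planted_tests.

(** * Risk of the high temperature test *)

Section risk_bounds.
Context (R : realType) (mu : probability (measurableTypeR R) R).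
Hypothesis tanh_mean0 : mean mu (@tanh R) = 0.
Variables (theta kappa M : R).
Hypotheses (theta0 : 0 <= theta) (M0 : 0 < M).
Hypothesis gain : forall n (S : {set 'I_n}), (1 < #|S|)%N ->
  1 + kappa <= \sum_s planted_law mu theta S s * Num.min (sqr_mag R S s) M.

Lemma risk_le k n m (psi : test n m) (b0 b1 : R) : 0 <= b1 ->
  iid_prob (fun=> 2^-1 ^+ n) psi <= b0 ->
  (forall S : {set 'I_n}, #|S| = k ->
    iid_prob (planted_law mu theta S) (predC psi) <= b1) ->
  risk mu theta k psi <= b0 + b1.
Proof.
move=> b10 null_le planted_le; rewrite /risk null_lawE//.
by apply: lerD => //; apply: bigmax_le => // S /eqP; exact: planted_le.
Qed.

Lemma risk_ge0 k n m (psi : test n m) : 0 <= risk mu theta k psi.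
Proof.
rewrite /risk null_lawE// addr_ge0//.
  by apply: iid_prob_ge0 => s; rewrite exprn_ge0// invr_ge0.
by apply: (big_ind (fun z => 0 <= z)) => [//|u v u0 v0|S _];
  [rewrite le_max u0 | apply: iid_prob_ge0 => s; exact: planted_law_ge0].
Qed.

Lemma scan_risk_le (tau d : R) : 1 < tau -> 0 < d -> tau + d <= 1 + kappa ->
  exists2 c : R, 0 < c & forall k n m, (1 < k)%N -> (0 < m)%N ->
    risk mu theta k (fun x : sample n m => tau <= phi1 R k x) <=
    n%:R ^+ k * expR (- (c * m%:R)) + M ^+ 2 / (m%:R * d ^+ 2).
Proof.
move=> tau1 d0 tau_d; have [c c0 tail] := null_phi1_tail tau1.
exists c => // k n m k1 m0; apply: risk_le.
- by rewrite divr_ge0 ?sqr_ge0// mulr_ge0 ?sqr_ge0.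
- exact/tail/m0/ltnW.
- move=> S cS; apply: (planted_phi1_tail m0 cS _ _ d0 M0).
  + exact: planted_law_ge0.
  + exact: planted_law1.
  + by apply: le_trans tau_d _; apply: gain; rewrite cS.
Qed.

Lemma sum_risk_le (tau d : R) : 0 < tau -> 0 < d -> tau + d + d <= kappa ->
  exists2 L : R, 0 < L & forall k n m, (1 < k)%N -> (k <= n)%N -> (0 < m)%N ->
    risk mu theta k (fun x : sample n m => tau < phi2 R k x) <=
    L * (n%:R ^+ 2 / (m%:R * k%:R ^+ 2)).
Proof.
move=> tau0 d0 tau_d; pose K := 4 / d + (4 * tau + 6) / d ^+ 2.
have K0 : 0 < K.
  have t6 : 0 < 4 * tau + 6 by rewrite addr_gt0// mulr_gt0.
  by rewrite addr_gt0// divr_gt0// exprn_gt0.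
exists (2 / tau ^+ 2 + (M ^+ 2 / d ^+ 2 + K)).
  apply: addr_gt0; first by rewrite divr_gt0 ?exprn_gt0.
  by apply: addr_gt0 => //; rewrite divr_gt0 ?exprn_gt0.
move=> k n m k1 kn m0; have k0 : (0 < k)%N by exact: ltnW.
have kR : 0 < k%:R :> R by rewrite ltr0n.
have mR : 0 < m%:R :> R by rewrite ltr0n.
set rho := n%:R ^+ 2 / (m%:R * k%:R ^+ 2).
have rho0 : 0 <= rho by rewrite divr_ge0 ?sqr_ge0// mulr_ge0 ?sqr_ge0.
rewrite mulrDl; apply: risk_le.
- by rewrite mulr_ge0// addr_ge0 ?divr_ge0 ?sqr_ge0// ltW.
- exact: null_phi2_tail.
- move=> S cS; rewrite mulrDl.
  apply: (le_trans (planted_phi2_tail k0 m0 cS (M := M) (e := 1 + tau + d)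
    _ _ d0 _ _ _ tau0 _)) => //.
  + exact: planted_law_ge0.
  + exact: planted_law1.
  + apply: le_trans (gain _); last by rewrite cS.
    by rewrite -!addrA lerD2l addrA.
  + by move=> eta s; exact: planted_law_twist.
  + by rewrite addrC addrA.
  + rewrite lerD2r.
    have -> : M ^+ 2 / (m%:R * d ^+ 2) = M ^+ 2 / d ^+ 2 * m%:R^-1.
      by field; rewrite !gt_eqF.
    rewrite ler_wpM2l ?divr_ge0 ?sqr_ge0// /rho invfM mulrCA.
    rewrite ler_peMr ?invr_ge0 ?ler0n// ler_pdivlMr ?exprn_gt0// mul1r.
    by rewrite lerXn2r ?nnegrE ?ler0n// ler_nat.
Qed.

End risk_bounds.

Section asymptotics.
Context (R : realType).

Lemma asymptotically_powerfulP (mu : probability (measurableTypeR R) R)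
    (theta : R) (n m : nat -> nat) (psi : forall k, test (n k) (m k)) :
  mean mu (@tanh R) = 0 -> 0 <= theta ->
  (forall eps : R, 0 < eps -> \forall k \near \oo, risk mu theta k (psi k) <= eps) ->
  asymptotically_powerful mu theta psi.
Proof.
move=> tanh0 theta0 small; apply/cvgrPdist_le => eps eps0.
near=> k; rewrite sub0r normrN ger0_norm ?risk_ge0//.
by near: k; exact: small.
Unshelve. all: end_near. Qed.

(** In the second regime the test therefore uses [phi2]. *)
Lemma not_small_planted_set (n : nat -> nat) (c : R) : (forall k, (k <= n k)%N) ->
  0 < c -> (\forall k \near \oo, c * (n k)%:R `^ (2 / 3) <= k%:R) ->
  ~ small_planted_set R n.
Proof.
move=> kn c0 k_ge /eqoP/(_ (c / 2)) small.
have {}small : \forall k \near \oo,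
    `|k%:R : R| <= c / 2 * `|(n k)%:R `^ (2 / 3) : R|.
  by apply: small; rewrite divr_gt0.
have : \forall k \near \oo, False.
  near=> k.
  have k1 : (0 < k)%N by near: k; exact: nbhs_infty_gt.
  have n0 : 0 < (n k)%:R `^ (2 / 3) :> R.
    by rewrite powR_gt0// ltr0n (leq_trans k1 (kn k)).
  have h1 : `|k%:R : R| <= c / 2 * `|(n k)%:R `^ (2 / 3) : R| by near: k.
  have h2 : c * (n k)%:R `^ (2 / 3) <= k%:R by near: k.
  have cn0 := mulr_gt0 c0 n0.
  rewrite !ger0_norm ?(ltW n0)// in h1.
  by move: h1 h2 cn0; set y := _ `^ _; lra.
by case=> N _ /(_ N (leqnn N)).
Unshelve. all: end_near. Qed.

(** With the constant [2 / c], half of the exponent cancels the [n ^+ k]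
    candidate sets and the other half is at least [k * ln n]. *)
Lemma scan_bound_le (c C0 : R) k n m : 0 < c -> 0 <= C0 -> (1 < k)%N -> (k <= n)%N ->
  (0 < m)%N -> 2 / c * (k%:R * ln n%:R) <= m%:R ->
  n%:R ^+ k * expR (- (c * m%:R)) + C0 / m%:R <=
  (1 + C0 * c / (2 * ln 2)) / k%:R.
Proof.
move=> c0 C00 k1 kn m0 mC.
have k0 : 0 < k%:R :> R by rewrite ltr0n ltnW.
have mR : 0 < m%:R :> R by rewrite ltr0n.
have n1 : (1 < n)%N by exact: leq_trans kn.
have nR : 0 < n%:R :> R by rewrite ltr0n ltnW.
have ln20 : 0 < ln 2 :> R by rewrite ln_gt0// ltr1n.
have ln2n : ln 2 <= ln n%:R :> R by rewrite ler_ln ?posrE// ler_nat.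
rewrite mulrDl; apply: lerD.
  have mc : k%:R * ln n%:R *+ 2 <= c * m%:R.
    have -> : k%:R * ln n%:R *+ 2 = c * (2 / c * (k%:R * ln n%:R)).
      by rewrite -[_ *+ 2]mulr_natr; field; rewrite gt_eqF.
    by rewrite ler_wpM2l// ltW.
  have nkE : expR (k%:R * ln n%:R) = n%:R ^+ k :> R.
    by rewrite expRM_natl lnK// posrE.
  apply: (@le_trans _ _ (n%:R ^+ k * expR (- (k%:R * ln n%:R *+ 2)))).
    by rewrite ler_wpM2l ?exprn_ge0// ler_expR lerN2.
  rewrite -nkE -expRD mulr2n opprD addrA subrr add0r expRN nkE mul1r.
  rewrite lef_pV2 ?posrE ?exprn_gt0// -natrX ler_nat (leq_trans kn)//.
  by rewrite -[leqLHS]expn1 leq_pexp2l// ltnW.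
have km : k%:R * (2 * ln 2 / c) <= m%:R.
  apply: le_trans mC.
  have -> : k%:R * (2 * ln 2 / c) = 2 / c * (k%:R * ln 2) by ring.
  by rewrite ler_wpM2l ?divr_ge0 ?(ltW c0)// ler_wpM2l// ltW.
have -> : C0 * c / (2 * ln 2) / k%:R = C0 * (k%:R * (2 * ln 2 / c))^-1.
  by field; rewrite !gt_eqF.
by rewrite ler_wpM2l// lef_pV2// posrE !mulr_gt0// invr_gt0.
Qed.

End asymptotics.

Theorem theorem3p2 (R : realType) (mu : probability (measurableTypeR R) R)
    (theta1 : R) (a : R)
    (a_def : a = mean mu (fun h => sech h ^+ 2))
    (tanh_mean0 : mean mu (fun h => tanh h) = 0)
    (theta1_gt0 : 0 < theta1)
    (theta1_lt_crit : theta1 < a^-1) :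
  exists tau1 tau2 : R,
    [/\ 0 < tau1 < (1 - theta1 * a ^+ 2) / (1 - theta1 * a) ^+ 2,
        0 < tau2 < (2 * theta1 * a - theta1 * (1 + theta1) * a ^+ 2)
                     / (1 - theta1 * a) ^+ 2,
        (* k = o(n^(2/3)) and m >= C k log n *)
        (exists2 C : R, 0 < C & forall n m : nat -> nat,
           (forall k, (k <= n k)%N) -> (forall k, (0 < m k)%N) ->
           small_planted_set R n ->
           (\forall k \near \oo, C * (k%:R * ln (n k)%:R) <= (m k)%:R) ->
           asymptotically_powerful mu theta1
             (high_temperature_test tau1 tau2 n m)),
        (* c n^(2/3) <= k <= n and m >= C n^2 / k^2, with C depending only on
           the prescribed bound eps on the asymptotic risk *)
        (forall eps : R, 0 < eps ->
         exists2 C : R, 0 < C & forall n m : nat -> nat,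
           (forall k, (k <= n k)%N) -> (forall k, (0 < m k)%N) ->
           (exists2 c : R, 0 < c &
              \forall k \near \oo, c * (n k)%:R `^ (2 / 3) <= k%:R) ->
           (\forall k \near \oo,
              C * ((n k)%:R ^+ 2 / k%:R ^+ 2) <= (m k)%:R) ->
           \forall k \near \oo,
             risk mu theta1 k (high_temperature_test tau1 tau2 n m k) <= eps)
      & (* same regime, when the ratio of m to n^2 / k^2 exceeds every C *)
        (forall n m : nat -> nat,
           (forall k, (k <= n k)%N) -> (forall k, (0 < m k)%N) ->
           (exists2 c : R, 0 < c &
              \forall k \near \oo, c * (n k)%:R `^ (2 / 3) <= k%:R) ->
           (forall C : R, 0 < C -> \forall k \near \oo,
              C * ((n k)%:R ^+ 2 / k%:R ^+ 2) <= (m k)%:R) ->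
           asymptotically_powerful mu theta1
             (high_temperature_test tau1 tau2 n m))].
Proof.
have tanh0 : mean mu (@tanh R) = 0 by exact: tanh_mean0.
have theta0 := ltW theta1_gt0.
have a0 : 0 < a by rewrite -invr_gt0 (lt_trans theta1_gt0).
have a1 : a <= 1.
  by rewrite a_def mean_sech_sqr gerBl mean_tanh_sqr_ge0.
have ta1 : theta1 * a < 1 by rewrite -ltr_pdivlMr// mul1r.
have ta0 : 0 < theta1 * a by rewrite mulr_gt0.
pose v := (2 * theta1 * a - theta1 * (1 + theta1) * a ^+ 2) / (1 - theta1 * a) ^+ 2.
have den0 : 1 - theta1 * a != 0 by rewrite gt_eqF// subr_gt0.
have vE : (1 - theta1 * a ^+ 2) / (1 - theta1 * a) ^+ 2 = 1 + v.
  by rewrite /v; field.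
have v0 : 0 < v.
  rewrite /v divr_gt0 ?exprn_gt0 ?subr_gt0//.
  have -> : theta1 * (1 + theta1) * a ^+ 2 = theta1 * a * (a + theta1 * a) by ring.
  have -> : 2 * theta1 * a = theta1 * a * 2 by ring.
  by rewrite ltr_pM2l//; move: a1 ta1; lra.
have [kappa [M [kappa0 M0 gain]]] : exists kappa M : R, [/\ 0 < kappa, 0 < M &
    forall n (S : {set 'I_n}), (1 < #|S|)%N ->
    1 + kappa <= \sum_s planted_law mu theta1 S s * Num.min (sqr_mag R S s) M].
  by apply: planted_gain => //; rewrite -a_def.
(* [kappa] limits what the planted law guarantees and [v] is the length of the
   prescribed interval for the second threshold. *)
pose beta := Num.min kappa v.
have beta0 : 0 < beta by rewrite lt_min kappa0.
have beta_kappa : beta <= kappa by rewrite ge_min lexx.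
have beta_v : beta <= v by rewrite ge_min lexx orbT.
pose tau := beta / 2; pose d := beta / 4.
have tau0 : 0 < tau by rewrite divr_gt0.
have d0 : 0 < d by rewrite divr_gt0.
have [c c0 scan_risk] : exists2 c : R, 0 < c &
    forall k n m, (1 < k)%N -> (0 < m)%N ->
    risk mu theta1 k (fun x : sample n m => 1 + tau <= phi1 R k x) <=
    n%:R ^+ k * expR (- (c * m%:R)) + M ^+ 2 / (m%:R * d ^+ 2).
  apply: (scan_risk_le tanh0 theta0 M0 gain) => //; first by rewrite ltrDl.
  by rewrite /tau /d; lra.
have tau_d : tau + d + d <= kappa by rewrite /tau /d; lra.
have [L L0 sum_risk] := sum_risk_le tanh0 theta0 M0 gain tau0 d0 tau_d.
have sum_case (n m : nat -> nat) : (forall k, (k <= n k)%N) ->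
    (forall k, (0 < m k)%N) ->
    (exists2 c : R, 0 < c &
       \forall k \near \oo, c * (n k)%:R `^ (2 / 3) <= k%:R) ->
    forall eps : R, 0 < eps ->
    (\forall k \near \oo, L / eps * ((n k)%:R ^+ 2 / k%:R ^+ 2) <= (m k)%:R) ->
    \forall k \near \oo,
      risk mu theta1 k (high_temperature_test (1 + tau) tau n m k) <= eps.
  move=> kn m0 [c' c'0 k_ge] eps eps0 m_ge.
  have large := not_small_planted_set kn c'0 k_ge.
  near=> k.
  have k1 : (1 < k)%N by near: k; exact: nbhs_infty_gt.
  have -> : high_temperature_test (1 + tau) tau n m k =
      (fun x => tau < phi2 R k x).
    by apply/funext => x; rewrite /high_temperature_test; case: asboolP.
  apply: le_trans (sum_risk k (n k) (m k) k1 (kn k) (m0 k)) _.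
  have mk : L / eps * ((n k)%:R ^+ 2 / k%:R ^+ 2) <= (m k)%:R by near: k.
  have kR : 0 < k%:R :> R by rewrite ltr0n ltnW.
  have mR : 0 < (m k)%:R :> R by rewrite ltr0n.
  apply: (@le_trans _ _ ((m k)%:R * (eps / (m k)%:R))).
    have -> : L * ((n k)%:R ^+ 2 / ((m k)%:R * k%:R ^+ 2)) =
        L / eps * ((n k)%:R ^+ 2 / k%:R ^+ 2) * (eps / (m k)%:R).
      by field; rewrite !gt_eqF.
    by rewrite ler_wpM2r// divr_ge0// ltW.
  by rewrite mulrC divfK// gt_eqF.
exists (1 + tau), tau; split.
- by rewrite vE addr_gt0// ltrD2l /tau; lra.
- by rewrite tau0 -/v /tau; lra.
- exists (2 / c) => [|n m kn m0 small m_ge]; first by rewrite divr_gt0.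
  apply: asymptotically_powerfulP => // eps eps0.
  pose C0 := M ^+ 2 / d ^+ 2.
  near=> k.
  have k1 : (1 < k)%N by near: k; exact: nbhs_infty_gt.
  have kR : 0 < k%:R :> R by rewrite ltr0n ltnW.
  have -> : high_temperature_test (1 + tau) tau n m k =
      (fun x => 1 + tau <= phi1 R k x).
    by apply/funext => x; rewrite /high_temperature_test asboolT.
  apply: le_trans (scan_risk k (n k) (m k) k1 (m0 k)) _.
  rewrite [_ * d ^+ 2]mulrC invfM mulrA -/C0.
  apply: le_trans (scan_bound_le c0 _ k1 (kn k) (m0 k) _) _.
  + by rewrite divr_ge0 ?sqr_ge0.
  + by near: k.
  + rewrite ler_pdivrMr// -ler_pdivrMl// mulrC.
    by near: k; exact: nbhs_infty_ger.
- move=> eps eps0; exists (L / eps) => [|n m kn m0 k_ge m_ge]; first by rewrite divr_gt0.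
  exact: sum_case.
- move=> n m kn m0 k_ge m_ge; apply: asymptotically_powerfulP => // eps eps0.
  by apply: sum_case => //; apply: m_ge; rewrite divr_gt0.
Unshelve. all: end_near. Qed.
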